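(* Let $d\ge 2$ and let $\Gamma\in\mathbb{R}^{d\times d}$ be a symmetric positive definite matrix with smallest eigenvalue $\lambda_{\min}$. For $k=1,\dots,d-1$ let $A_k\in\mathbb{R}^{(d-k)\times k}$ be the subdiagonal block of $\Gamma$ consisting of its rows $k+1,\dots,d$ and columns $1,\dots,k$. Assume there is an integer $l\ge 1$ such that $\operatorname{rank}A_k\le l$ for all $k=1,\dots,d-1$. Let $\sigma_1^k,\dots,\sigma_l^k$ denote the $l$ largest singular values of $A_k$ (padded with zeros if necessary) and set $\sigma:=\max_{k,i}\sigma_i^k$. Let $f_\Gamma:\mathbb{R}^d\to\mathbb{R}$, $f_\Gamma(x)=e^{-\frac12 x^\top\Gamma x}$. Then for every $\varepsilon>0$ there exists an approximation $\hat f$ to $f_\Gamma$ with $$\|f_\Gamma-\hat f\|_{L^2(\mathbb{R}^d)}\le\varepsilon\,\|f_\Gamma\|_{L^2(\mathbb{R}^d)}$$ whose functional tensor-train (FTT) ranks $r_k$, $k=1,\dots,d-1$, are bounded by $$r_k\le\left(\left(1+7\frac{\sigma}{\lambda_{\min}}\right)\log\left(\frac{\sqrt 8\,d}{\varepsilon}\right)+\log\left(e^{3/2}\,\frac{l}{2}\right)\right)^{l}\le\left(\left(1+7\frac{\sigma}{\lambda_{\min}}\right)\log\left(7\,l\,\frac{d}{\varepsilon}\right)\right)^{l}.$$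
   Context: A function $g\in L^2(\mathbb{R}^d)$ has a functional tensor-train (FTT) decomposition with finite FTT ranks $(r_1,\dots,r_{d-1})$, $r_k\in\mathbb{N}$ (with $r_0=r_d=1$), if there are functions $\gamma_j:\{1,\dots,r_{j-1}\}\times\mathbb{R}\times\{1,\dots,r_j\}\to\mathbb{R}$, $j=1,\dots,d$, measurable in the real variable, such that $$g(x_1,\dots,x_d)=\sum_{\alpha_1=1}^{r_1}\cdots\sum_{\alpha_{d-1}=1}^{r_{d-1}}\gamma_1(1,x_1,\alpha_1)\,\gamma_2(\alpha_1,x_2,\alpha_2)\cdots\gamma_d(\alpha_{d-1},x_d,1)$$ in $L^2(\mathbb{R}^d)$. ''The FTT ranks of $\hat f$ are bounded by given numbers'' means that such a decomposition of $\hat f$ exists with ranks satisfying these bounds. $\log$ is the natural logarithm.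
   Formalization: Instead of every ε>0, the formal theorem also assumes that the base (1+7σ/λ_min)log(√8 d/ε)+log(e^{3/2} l/2) is at least 1 (automatic for ε ≤ 2d); for much larger ε the base can be negative or below 1, and the claim fails, e.g. d=2, Γ=I, l=1, ε=1000. *)

(* Defs.v *)
From HB Require Import structures.
From mathcomp Require Import all_boot all_order all_algebra.
From mathcomp Require Import all_classical all_reals all_analysis.
From mathcomp Require Import lra.

Set Implicit Arguments.
Unset Strict Implicit.
Unset Printing Implicit Defensive.

Import Order.TTheory GRing.Theory Num.Theory.
Import numFieldNormedType.Exports.

Local Open Scope classical_set_scope.
Local Open Scope ring_scope.

Notation Rn R d := (d.-tuple (measurableTypeR R)).

Section LebesgueRn.
Context (R : realType).

Definition tcons (n : nat) (p : measurableTypeR R * Rn R n) : Rn R n.+1 :=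
  [the n.+1.-tuple (measurableTypeR R) of p.1 :: p.2].

Lemma measurable_tcons (n : nat) : measurable_fun [set: _] (@tcons n).
Proof. exact: measurable_cons. Qed.

Section lebesgue_cons.
Context (n : nat) (mu : {measure set (Rn R n) -> \bar R}).

Definition lebesgue_cons : set (Rn R n.+1) -> \bar R :=
  pushforward (product_measure2 (@lebesgue_measure R) mu) (@tcons n).

Let lebesgue_cons0 : lebesgue_cons set0 = 0%E.
Proof. by rewrite /lebesgue_cons /pushforward preimage_set0 measure0. Qed.

Let lebesgue_cons_ge0 A : (0 <= lebesgue_cons A)%E.
Proof.
exact: (measure_ge0 (product_measure2 (@lebesgue_measure R) mu)).
Qed.

Let lebesgue_cons_sigma_additive : semi_sigma_additive lebesgue_cons.
Proof.
rewrite /lebesgue_cons => F mF tF mUF.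
rewrite /pushforward preimage_bigcup.
have mpre A : measurable A -> measurable (@tcons n @^-1` A).
  by move=> mA; rewrite -[X in measurable X]setTI; exact: measurable_tcons.
apply: measure_semi_sigma_additive.
- by move=> i; apply: mpre; exact: mF.
- apply/trivIsetP => /= i j _ _ ij; rewrite -preimage_setI.
  by move/trivIsetP : tF => /(_ _ _ _ _ ij) ->//; rewrite preimage_set0.
- by rewrite -preimage_bigcup; exact: mpre.
Qed.

HB.instance Definition _ := isMeasure.Build _ _ _ lebesgue_cons
  lebesgue_cons0 lebesgue_cons_ge0 lebesgue_cons_sigma_additive.

End lebesgue_cons.

(* R^0 is a point of mass 1, and R^(n+1) carries the image under tcons of the
   product of the Lebesgue measures of R and R^n; lebesgue_Rn_box below is the
   property that determines this measure. *)
Fixpoint lebesgue_Rn (n : nat) : {measure set (Rn R n) -> \bar R} :=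
  if n is m.+1 then lebesgue_cons (lebesgue_Rn m)
  else \d_ ([tuple] : Rn R 0).

Lemma lebesgue_Rn_box (n : nat) (A : 'I_n -> set (measurableTypeR R)) :
  (forall i, measurable (A i)) ->
  lebesgue_Rn n [set t | forall i, A i (tnth t i)] =
  (\prod_(i < n) (@lebesgue_measure R) (A i))%E.
Proof.
elim: n A => [|n IHn] A mA.
  rewrite big_ord0 /= diracE mem_set// => i; by case: i.
rewrite big_ord_recl /= /lebesgue_cons /pushforward.
rewrite -(IHn (fun i => A (lift ord0 i)))//.
set B := [set t : Rn R n | _].
have mB : measurable B.
  have -> : B = \bigcap_(i in [set: 'I_n])
      ((fun t : Rn R n => tnth t i) @^-1` A (lift ord0 i)).
    by apply/seteqP; split=> t /= h i; [move=> _; exact: h|exact: h].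
  apply: fin_bigcap_measurable; first exact: finite_finset.
  by move=> i _; rewrite -[X in measurable X]setTI; exact: measurable_tnth.
rewrite -product_measure2E//; congr product_measure2.
apply/seteqP; split=> -[x t] /=.
  move=> h; split; first by have := h ord0; rewrite tnth0.
  by move=> i; have := h (lift ord0 i); rewrite tnthS.
move=> [hx ht] i; case: (unliftP ord0 i) => [j ->|->].
  by rewrite tnthS; exact: ht.
by rewrite tnth0.
Qed.

End LebesgueRn.

Section Matrices.
Context (R : realType).

Definition posdefmx (n : nat) (G : 'M[R]_n) : Prop :=
  forall v : 'cV[R]_n, v != 0 -> 0 < (v^T *m G *m v) 0 0.

Definition smallest_eigenvalue (n : nat) (G : 'M[R]_n) (a : R) : Prop :=
  eigenvalue G a /\ (forall b : R, eigenvalue G b -> a <= b).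

(* Rows k, ..., d-1 and columns 0, ..., k-1 in the numbering from 0. *)
Definition subdiag_block (d : nat) (G : 'M[R]_d) (k : 'I_d) :
    'M[R]_(d - k, k) :=
  \matrix_(i < d - k, j < k)
    G (cast_ord (subnKC (ltnW (ltn_ord k))) (rshift k i))
      (widen_ord (ltnW (ltn_ord k)) j).

(* s lists, in decreasing order and with multiplicity, the square roots of the
   n eigenvalues of A^T A, which are the min(m, n) singular values of A
   followed by zeros. *)
Definition singular_values (m n : nat) (A : 'M[R]_(m, n)) (s : seq R) : Prop :=
  [/\ sorted (fun x y => y <= x) s, all (fun x => 0 <= x) s &
      char_poly (A^T *m A) = \prod_(x <- s) ('X - (x ^+ 2)%:P)].

End Matrices.

Section Gaussian.
Context (R : realType) (d : nat).

Definition colvec (x : Rn R d) : 'cV[R]_d := \col_i (tnth x i : R).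

Definition gaussian (G : 'M[R]_d) (x : Rn R d) : R :=
  expR (- (2^-1) * ((colvec x)^T *m G *m colvec x) 0 0).

End Gaussian.

Section FTT.
Context (R : realType) (d : nat).

(* Core j (from 0) maps (alpha_j, x_j, alpha_(j+1)) to a real; with
   r 0 = r d = 1 the indices alpha_0 and alpha_d take a single value. *)
Definition ftt_cores (r : nat -> nat) : Type :=
  forall j : nat, 'I_(r j) -> measurableTypeR R -> 'I_(r j.+1) -> R.

Definition ftt_eval (r : nat -> nat) (gamma : ftt_cores r) (x : Rn R d) : R :=
  \sum_(alpha : {dffun forall k : 'I_d.+1, 'I_(r k)})
    \prod_(j < d)
      @gamma j (alpha (widen_ord (leqnSn d) j)) (tnth x j)
             (alpha (lift ord0 j)).

Definition has_ftt (g : Rn R d -> R) (r : nat -> nat) : Prop :=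
  [/\ r 0%N = 1%N, r d = 1%N, (forall k, (0 < k < d)%N -> (1 <= r k)%N) &
      exists gamma : ftt_cores r,
        (forall j (a : 'I_(r j)) (b : 'I_(r j.+1)), (j < d)%N ->
           measurable_fun [set: measurableTypeR R] (fun t => gamma j a t b)) /\
        g = ftt_eval gamma %[ae lebesgue_Rn R d]].

End FTT.

Section RankBound.
Context (R : realType).

(* The l-th power of rank_base bounds the ranks.  For eps much larger than d it
   falls below 1 (it can even be negative), where no rank r_k >= 1 satisfies
   r_k <= rank_base for l = 1; this does not happen for eps <= 2 * d. *)
Definition rank_base (d l : nat) (sigma lmin eps : R) : R :=
  (1 + 7 * (sigma / lmin)) * ln (Num.sqrt 8 * d%:R / eps)
  + ln (expR (3 / 2) * (l%:R / 2)).

Lemma rank_base_ge1 (d l : nat) (sigma lmin eps : R) :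
  (0 < d)%N -> (0 < l)%N -> 0 <= sigma -> 0 < lmin ->
  0 < eps -> eps <= 2 * d%:R -> 1 <= rank_base d l sigma lmin eps.
Proof.
move=> d0 l0 s0 lm0 e0 ed.
have dR : (1 : R) <= d%:R by rewrite ler1n.
have lR : (1 : R) <= l%:R by rewrite ler1n.
have s2 : Num.sqrt (8 : R) = 2 * Num.sqrt 2.
  have -> : (8 : R) = 2 ^+ 2 * 2 by rewrite -natrX -natrM.
  by rewrite sqrtrM ?exprn_ge0// sqrtr_sqr ger0_norm.
have sq2 : (0 : R) < Num.sqrt 2 by rewrite sqrtr_gt0.
have ln2 : ln (Num.sqrt (2 : R)) *+ 2 = ln 2.
  by rewrite -lnXn// sqr_sqrtr.
have ln2_le1 : ln (2 : R) <= 1.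
  by have := @le_ln1Dx R 1 ltac:(lra); rewrite (_ : 1 + 1 = 2 :> R)//; lra.
have ln2_ge0 : 0 <= ln (2 : R) by rewrite ln_ge0//; lra.
have a1 : ln (Num.sqrt 2) <= ln (Num.sqrt 8 * d%:R / eps).
  rewrite ler_ln ?posrE//; last first.
    by rewrite divr_gt0// mulr_gt0 ?sqrtr_gt0//; lra.
  by rewrite ler_pdivlMr// s2; nra.
have a2 : 3 / 2 - ln 2 <= ln (expR (3 / 2) * (l%:R / 2)) :> R.
  rewrite lnM ?posrE ?expR_gt0//; last by lra.
  rewrite expRK lerD2l -lnV ?posrE// ler_ln ?posrE//; lra.
have sl : 0 <= sigma / lmin by rewrite divr_ge0// ltW.
rewrite /rank_base; nra.
Qed.

End RankBound.

(* Main.v *)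
(* At the cut between the first k and the last d - k variables, the Gaussian is
   the exponential of the block diagonal part of the form times exp (- y^T A x)
   with A = A_k of rank rho <= l.  Truncating the latter at degree N leaves a
   sum of 'C(N + rho, rho) products, since y^T A x is a sum of rho products.
   The Taylor tail of exp is at most q ^ -N exp (q |s|), so the squared L^2
   error at the cut is q ^ (-2 N) times the integral of Gaussians whose
   off-diagonal blocks are multiplied by at most q = 1 + lmin / (2 sigma).  The
   form of such a Gaussian dominates G up to rho rank-one squares, each of which
   changes the integral by a factor at most sqrt 2 (integral_gauss_rank_one).

   The d - 1 cuts are combined without singular value decompositions in L^2: the
   Gaussian is sampled on a grid, the sampled tensor is rounded to a tensor train
   by successive orthogonal projections, whose squared errors add up over the
   cuts, and the result is extended to a step function.  The discretization
   error vanishes as the grid is refined, so it fits between the sum of the cut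
   errors and eps ^ 2 / 2. *)
Require Import Defs.
From HB Require Import structures.
From mathcomp Require Import all_boot all_order all_algebra.
From mathcomp Require Import all_classical all_reals all_analysis.
From mathcomp Require Import measurable_realfun ring lra.
From mathcomp.real_closed Require Import complex.

Set Implicit Arguments.
Unset Strict Implicit.
Unset Printing Implicit Defensive.

Import Order.TTheory GRing.Theory Num.Theory.
Import numFieldNormedType.Exports.

Local Open Scope classical_set_scope.
Local Open Scope ring_scope.

(** * Orthogonal projections *)

(** The budget: each cut may contribute [eps ^ 2 / (2 d)] of the squared norm of the Gaussian. The d
    - 1 cuts then stay strictly below [eps ^ 2 / 2], which leaves room for the discretization error,
    and the inequality (x + y) ^ 2 <= 2 (x ^ 2 + y ^ 2), used once to join sampling and rounding,
    costs the remaining factor 2.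

    The difficulty is the factor sqrt 2 per rank in the cut error. Its logarithm is linear in rho,
    so the Taylor degree N must contain a term linear in rho, whereas the base of the rank bound has
    only a logarithm of l to spare. The estimate 'C(N + rho, rho) <= (1 + N (1 + ln rho) / rho) ^
    rho divides that term by rho and leaves only a multiple of ln rho.

    The choice of q balances two demands: the stretched form must keep at least half of lmin, and 1
    / ln q, which multiplies the degree, must stay below 1 + 2 sigma / lmin.

    Two cases are separate: for eps >= 1 the zero function serves, and a cut with zero block needs
    one Taylor term, so that sigma > 0 wherever it is divided by. *)

Lemma sum_sqr_ge0 (R : realDomainType) (I : finType) (F : I -> R) :
  0 <= \sum_i F i ^+ 2.
Proof. by apply: sumr_ge0 => i _; exact: sqr_ge0. Qed.

Definition sqn (R : nzRingType) n (v : 'cV[R]_n) : R := (v^T *m v) 0 0.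

Lemma sqnE (R : nzRingType) n (v : 'cV[R]_n) : sqn v = \sum_i v i 0 ^+ 2.
Proof. by rewrite /sqn mxE; apply: eq_bigr => i _; rewrite mxE expr2. Qed.

Lemma sqn_ge0 (R : realDomainType) n (v : 'cV[R]_n) : 0 <= sqn v.
Proof. by rewrite sqnE; exact: sum_sqr_ge0. Qed.

Lemma sqn_eq0 (R : realDomainType) n (v : 'cV[R]_n) : (sqn v == 0) = (v == 0).
Proof.
rewrite sqnE psumr_eq0; last by move=> i _; exact: sqr_ge0.
apply/allP/eqP => [h|-> i _]; last by rewrite /= mxE expr0n eqxx.
apply/matrixP => i j; rewrite ord1 mxE; apply/eqP.
by have := h i (mem_index_enum i); rewrite /= sqrf_eq0.
Qed.

Lemma mul_rV_cV_neq0 (R : rcfType) n (u : 'rV[R]_n) : u != 0 ->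
  exists2 c : R, c != 0 & u *m u^T = (c ^+ 2)%:M.
Proof.
move=> u0; exists (Num.sqrt (sqn u^T)).
  by rewrite sqrtr_eq0 -ltNge lt_def sqn_ge0 sqn_eq0 andbT -trmx0 (inj_eq trmx_inj).
by rewrite sqr_sqrtr ?sqn_ge0// {1}(mx11_scalar (u *m u^T)) /sqn trmxK.
Qed.

(** Each row is orthonormalized against the rows below it. A row that depends on those gives a zero
    row of [V]; hence [V] is only a partial isometry, but it keeps [r] rows whatever the rank of
    [M]. *)
Lemma gram_schmidt (R : rcfType) r n (M : 'M[R]_(r, n)) :
  exists V : 'M[R]_(r, n), V *m V^T *m V = V /\ M *m V^T *m V = M.
Proof.
elim: r M => [|r IHr] M.
  by exists M; split; rewrite flatmx0 [RHS]flatmx0.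
rewrite -[r.+1]/(1 + r)%N in M *.
set m0 := usubmx M; set M' := dsubmx M.
have [V [VV MV]] := IHr M'.
have VVt : V^T *m V *m V^T = V^T.
  by rewrite -[RHS](congr1 trmx VV) !trmx_mul trmxK mulmxA.
(* The part of the top row orthogonal to the rows already treated: it is dropped if zero and
   normalized otherwise. *)
pose u := m0 - m0 *m V^T *m V.
have uV : u *m V^T = 0.
  by rewrite mulmxBl -!mulmxA (mulmxA V^T) VVt subrr.
have m0E : m0 = u + m0 *m V^T *m V by rewrite subrK.
have [u0|/mul_rV_cV_neq0[c c0 uu]] := eqVneq u 0.
  exists (col_mx 0 V); rewrite -[M]vsubmxK -/m0 -/M' tr_col_mx trmx0 -!mulmxA.
  rewrite mul_row_col mul0mx add0r !mul_col_mx mul0mx !mulmxA VV MV.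
  by split=> //; rewrite {2}m0E u0 add0r.
pose w := c^-1 *: u.
have ww : w *m w^T = 1%:M.
  rewrite /w -scalemxAl [_^T]linearZ -scalemxAr uu -scalemx1 !scalerA.
  by rewrite (_ : _ * c ^+ 2 = 1) ?scale1r//; field.
have wV : w *m V^T = 0 by rewrite /w -scalemxAl uV scaler0.
have cw : c *: w = u by rewrite /w scalerA divff// scale1r.
clearbody w.
have Vw : V *m w^T = 0 by rewrite -[LHS]trmxK trmx_mul trmxK wV trmx0.
have uw : u *m w^T *m w = u.
  by rewrite -{1}cw -!scalemxAl ww mul1mx.
exists (col_mx w V); rewrite -[M]vsubmxK -/m0 -/M' tr_col_mx -!mulmxA.
rewrite mul_row_col !mul_col_mx !mulmxDr !mulmxA ww mul1mx wV mul0mx addr0.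
rewrite Vw mul0mx add0r VV MV; split=> //; congr col_mx.
  rewrite {1}m0E mulmxDl mulmxDl uw -(mulmxA _ V) Vw mulmx0 mul0mx addr0.
  by rewrite -m0E.
by rewrite -{1}MV -(mulmxA _ V) Vw mulmx0 mul0mx add0r.
Qed.

Section PartialIsometry.
Variables (R : realDomainType) (r n : nat) (V : 'M[R]_(r, n)).
Hypothesis VV : V *m V^T *m V = V.

Lemma pisom_trK : V^T *m V *m V^T = V^T.
Proof. by rewrite -[RHS](congr1 trmx VV) !trmx_mul trmxK mulmxA. Qed.

Lemma sqn_sub_proj (x : 'cV[R]_n) :
  sqn (x - V^T *m V *m x) = sqn x - sqn (V *m x).
Proof.
rewrite /sqn [_^T]linearB/= !trmx_mul trmxK !mulmxBr !mulmxBl -!mulmxA.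
rewrite (mulmxA V V^T (V *m x)) (mulmxA (V *m V^T)) VV subrr subr0.
by rewrite !mxE.
Qed.

Lemma sqn_pisom (x : 'cV[R]_n) : sqn (V *m x) <= sqn x.
Proof. by rewrite -subr_ge0 -sqn_sub_proj sqn_ge0. Qed.

Lemma sqn_proj_le (g h : 'cV[R]_n) :
  V^T *m V *m h = h -> sqn (g - V^T *m V *m g) <= sqn (g - h).
Proof.
move=> hh.
have -> : g - V^T *m V *m g = (g - h) - V^T *m V *m (g - h).
  by rewrite mulmxBr hh opprB addrA subrK.
by rewrite sqn_sub_proj lerBlDr lerDl sqn_ge0.
Qed.

End PartialIsometry.

Lemma sqn_pisom_tr (R : realDomainType) r n (V : 'M[R]_(r, n)) (y : 'cV[R]_r) :
  V *m V^T *m V = V -> sqn (V^T *m y) <= sqn y.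
Proof. by move=> VV; apply: sqn_pisom; rewrite trmxK pisom_trK. Qed.

Lemma sqnD_orth (R : comNzRingType) n (a b : 'cV[R]_n) :
  a^T *m b = 0 -> sqn (a + b) = sqn a + sqn b.
Proof.
move=> ab; have ba : b^T *m a = 0 by rewrite -[LHS]trmxK trmx_mul trmxK ab trmx0.
by rewrite /sqn [_^T]linearD/= mulmxDl !mulmxDr ab ba addr0 add0r !mxE.
Qed.

(** Pythagoras: [g - V^T *m V *m g] is orthogonal to the range of [V^T]. Since squared errors add,
    rounding at successive cuts loses no constant. *)
Lemma sqn_proj_split (R : realDomainType) r n (V : 'M[R]_(r, n))
    (g : 'cV[R]_n) (h : 'cV[R]_r) : V *m V^T *m V = V ->
  sqn (g - V^T *m h) <= sqn (g - V^T *m V *m g) + sqn (V *m g - h).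
Proof.
move=> VV; have -> : g - V^T *m h = (g - V^T *m V *m g) + V^T *m (V *m g - h).
  by rewrite mulmxBr mulmxA addrA subrK.
rewrite sqnD_orth; first by rewrite lerD2l sqn_pisom_tr.
rewrite mulmxA -[X in X *m _]trmx_mul (_ : V *m (g - _) = 0) ?trmx0 ?mul0mx//.
by rewrite mulmxBr !mulmxA VV subrr.
Qed.

(** [Q] holds the Gram-Schmidt vectors of the functions [phi _ b]. The second inequality is one
    rounding step: the projection onto their span beats every combination [c], and approximating its
    coordinates by [h] adds its own squared error. *)
Lemma finite_projection (R : rcfType) (X : finType) r (phi : X -> 'I_r -> R) :
  exists Q : X -> 'I_r -> R,
    (forall g : X -> R,
       \sum_b (\sum_x Q x b * g x) ^+ 2 <= \sum_x g x ^+ 2) /\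
    (forall (g : X -> R) (c h : 'I_r -> R),
       \sum_x (g x - \sum_b Q x b * h b) ^+ 2 <=
       \sum_x (g x - \sum_b phi x b * c b) ^+ 2 +
       \sum_b (\sum_x Q x b * g x - h b) ^+ 2).
Proof.
pose M : 'M[R]_(r, #|X|) := \matrix_(b, i) phi (enum_val i) b.
have [V [VV MV]] := gram_schmidt M.
pose Q x b := V b (enum_rank x).
pose vec (g : X -> R) : 'cV[R]_#|X| := \col_i g (enum_val i).
have sumX (F : X -> R) : \sum_x F x = \sum_(i < #|X|) F (enum_val i).
  rewrite (reindex (@enum_val X predT))//=.
  by exists enum_rank => x _; rewrite ?enum_valK ?enum_rankK.
have sqv g : \sum_x g x ^+ 2 = sqn (vec g).
  by rewrite sqnE sumX; apply: eq_bigr => i _; rewrite mxE.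
have Vv g b : \sum_x Q x b * g x = (V *m vec g) b 0.
  by rewrite mxE sumX; apply: eq_bigr => i _; rewrite /Q enum_valK mxE.
exists Q; split=> [g|g c h].
  rewrite sqv -(eq_bigr _ (fun b _ => congr1 (fun z => z ^+ 2) (esym (Vv g b)))).
  by rewrite -sqnE sqn_pisom.
pose hv : 'cV[R]_r := \col_b h b; pose cv : 'cV[R]_r := \col_b c b.
have -> : \sum_x (g x - \sum_b Q x b * h b) ^+ 2 = sqn (vec g - V^T *m hv).
  rewrite sqv; congr sqn; apply/matrixP => i j; rewrite !mxE; congr (_ - _).
  by apply: eq_bigr => b _; rewrite !mxE /Q enum_valK.
have -> : \sum_x (g x - \sum_b phi x b * c b) ^+ 2 = sqn (vec g - M^T *m cv).
  rewrite sqv; congr sqn; apply/matrixP => i j; rewrite !mxE; congr (_ - _).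
  by apply: eq_bigr => b _; rewrite !mxE.
have -> : \sum_b (\sum_x Q x b * g x - h b) ^+ 2 = sqn (V *m vec g - hv).
  by rewrite sqnE; apply: eq_bigr => b _; rewrite Vv !mxE.
apply: (le_trans (sqn_proj_split _ _ VV)); rewrite lerD2r.
apply: sqn_proj_le => //; rewrite mulmxA; congr (_ *m _).
by rewrite -[RHS](congr1 trmx MV) !trmx_mul trmxK mulmxA.
Qed.

(** * Tensor trains over a finite index set *)

Lemma sum_tupleS (V : nmodType) (I : finType) n (F : n.+1.-tuple I -> V) :
  \sum_t F t = \sum_x \sum_(t : n.-tuple I) F [tuple of x :: t].
Proof.
rewrite pair_bigA/= (reindex (fun p : I * n.-tuple I => [tuple of p.1 :: p.2]))//.
exists (fun t : n.+1.-tuple I => (thead t, [tuple of behead t])).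
  by move=> [x t] _ /=; congr (_, _); exact: val_inj.
by move=> t _; case/tupleP: t => x t; exact: val_inj.
Qed.

(* Row a of the product of the matrices [g j (x_j)], summed over the columns, of
   which there is only one when [r d = 1]. *)
Fixpoint tt_val (R : pzSemiRingType) (I : Type) (s : seq I) (r : nat -> nat)
    (g : forall j, 'I_(r j) -> I -> 'I_(r j.+1) -> R) (a : 'I_(r 0%N)) : R :=
  if s is x :: s' then
    \sum_b g 0%N a x b * tt_val s' (fun j => g j.+1) b
  else 1.

Definition tt_cores_cons (R : Type) (I : Type) (r : nat -> nat)
    (Q : 'I_(r 0%N) -> I -> 'I_(r 1%N) -> R)
    (g : forall j, 'I_(r j.+1) -> I -> 'I_(r j.+2) -> R) :
    forall j, 'I_(r j) -> I -> 'I_(r j.+1) -> R :=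
  fun j => match j with 0%N => Q | j'.+1 => g j' end.

(** Induction on the number of variables, with a free left index [a] in ['I_(r 0%N)]. The pair ([a],
    first variable) is projected onto the span of the left factors of the first cut, and the
    coordinates form a tensor with one variable less. The projection acts on left variables only and
    is a contraction, so the later cuts keep their ranks and their errors do not grow. *)
Lemma tt_rounding (R : rcfType) (I : finType) n (r : nat -> nat)
    (c : 'I_(r 0%N) -> seq I -> R) (cut : nat -> 'I_(r 0%N) -> seq I -> R) :
  r n.+1 = 1%N ->
  (forall k, (0 < k < n.+1)%N -> exists phi psi, forall a s, size s = n.+1 ->
     cut k a s = \sum_(b < r k) phi a (take k s) b * psi b (drop k s)) ->
  exists g : forall j, 'I_(r j) -> I -> 'I_(r j.+1) -> R,
    \sum_a \sum_(s : n.+1.-tuple I) (c a s - tt_val s g a) ^+ 2 <=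
    \sum_(1 <= k < n.+1) \sum_a \sum_(s : n.+1.-tuple I)
       (c a s - cut k a s) ^+ 2.
Proof.
elim: n r c cut => [|n IHn] r c cut rn hcut.
  (* With one variable left the core is the tensor itself; it may ignore its right index, which
     takes a single value because [r 1 = 1]. *)
  exists (tt_cores_cons (fun a x _ => c a [:: x]) (fun _ _ _ _ => 0)).
  rewrite big_geq// big1// => a _; rewrite big1// => s _.
  case/tupleP: s => x s; rewrite tuple0 /= (eq_bigr (fun=> c a [:: x])).
    by rewrite sumr_const card_ord rn mulr1n subrr expr0n.
  by move=> b _; rewrite mulr1.
have [phi1 [psi1 hcut1]] := hcut 1%N isT.
have [Q [Qcontr Qbest]] := finite_projection
  (fun p : 'I_(r 0%N) * I => phi1 p.1 [:: p.2]).
(* The coordinates of the tensor under the projection; [cut'] transforms the remaining cut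
   approximations in the same way. *)
pose c' b s := \sum_(p : 'I_(r 0%N) * I) Q p b * c p.1 (p.2 :: s).
pose cut' k b s := \sum_(p : 'I_(r 0%N) * I) Q p b * cut k.+1 p.1 (p.2 :: s).
have [k /andP[k0 kn]|g hg] := IHn (fun j => r j.+1) c' cut' rn.
  have [phi [psi h]] := hcut k.+1 kn.
  exists (fun b s d => \sum_(p : 'I_(r 0%N) * I) Q p b * phi p.1 (p.2 :: s) d).
  exists psi => b s ss; rewrite /cut'.
  under eq_bigr do rewrite h/= ?ss// mulr_sumr.
  rewrite exchange_big/=; apply: eq_bigr => d _.
  by rewrite mulr_suml; apply: eq_bigr => p _; rewrite mulrA.
exists (tt_cores_cons (fun a x b => Q (a, x) b) g).
have sumE (F : 'I_(r 0%N) -> seq I -> R) :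
    \sum_a \sum_(s : n.+2.-tuple I) F a s =
    \sum_(s : n.+1.-tuple I) \sum_(p : 'I_(r 0%N) * I) F p.1 (p.2 :: s).
  under eq_bigr do rewrite sum_tupleS.
  rewrite pair_bigA/= exchange_big/=; apply: eq_bigr => s _.
  by rewrite -(pair_bigA _ (fun a x => F a (x :: s))).
rewrite (sumE (fun a s => (c a s - tt_val s _ a) ^+ 2)) big_ltn//.
apply: (@le_trans _ _ (\sum_(s : n.+1.-tuple I)
    (\sum_(p : 'I_(r 0%N) * I) (c p.1 (p.2 :: s) - cut 1%N p.1 (p.2 :: s)) ^+ 2 +
     \sum_b (c' b s - tt_val s g b) ^+ 2))).
  apply: ler_sum => s _.
  have := Qbest (fun p => c p.1 (p.2 :: s)) (fun b => psi1 b s)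
    (fun b => tt_val s g b).
  congr (_ <= _ + _); apply: eq_bigr => -[a x] _ //=.
  by rewrite hcut1/= ?size_tuple// take0 drop0.
rewrite big_split/= (sumE (fun a s => (c a s - cut 1%N a s) ^+ 2)) lerD2l.
rewrite exchange_big/=; apply: (le_trans hg).
rewrite [leRHS]big_add1 /=; apply: ler_sum_nat => k _.
rewrite (sumE (fun a s => (c a s - cut k.+1 a s) ^+ 2)) exchange_big/=.
apply: ler_sum => s _.
have := Qcontr (fun p => c p.1 (p.2 :: s) - cut k.+1 p.1 (p.2 :: s)).
congr (_ <= _); apply: eq_bigr => b _; congr (_ ^+ 2).
by rewrite -sumrB; apply: eq_bigr => p _; rewrite mulrBr.
Qed.

Section DependentCons.
Variables (n : nat) (T : 'I_n.+1 -> finType).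

(** The summation indices of [ftt_eval] have types that depend on the position, so prepending one
    requires a cast along the equation that identifies the position. *)
Definition dcons (a : T ord0) (f : {dffun forall k : 'I_n, T (lift ord0 k)})
    (k : 'I_n.+1) : T k :=
  match unliftP ord0 k in unlift_spec _ _ _ with
  | UnliftSome j e => ecast z (T z) (esym e) (f j)
  | UnliftNone e => ecast z (T z) (esym e) a
  end.

Lemma dcons0 a f : dcons a f ord0 = a.
Proof.
rewrite /dcons; case: (unliftP ord0 ord0) => [j e|e].
  by have := congr1 val e.
by rewrite (eq_irrelevance e erefl).
Qed.

Lemma dconsS a f k : dcons a f (lift ord0 k) = f k.
Proof.
rewrite /dcons; case: (unliftP ord0 (lift ord0 k)) => [j e|e].
  have kj := lift_inj e; rewrite -{}kj in e *.
  by rewrite (eq_irrelevance e erefl).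
by have := congr1 val e.
Qed.

Lemma sum_dffunS (V : nmodType) (F : {dffun forall k : 'I_n.+1, T k} -> V) :
  \sum_f F f = \sum_a \sum_f F [ffun k => dcons a f k].
Proof.
rewrite pair_bigA/= (reindex (fun p : T ord0 *
  {dffun forall k : 'I_n, T (lift ord0 k)} =>
    [ffun k => dcons p.1 p.2 k] : {dffun forall k, T k}))//.
exists (fun f : {dffun forall k : 'I_n.+1, T k} =>
  (f ord0, [ffun k => f (lift ord0 k)])).
  move=> [a f] _ /=; rewrite ffunE dcons0; congr (_, _).
  by apply/ffunP => k; rewrite !ffunE dconsS.
move=> f _; apply/ffunP => k; rewrite ffunE.
by case: (unliftP ord0 k) => [j|] ->; rewrite ?dcons0 ?dconsS ?ffunE.
Qed.

End DependentCons.

Lemma tt_val_sum (R : comPzSemiRingType) (I : Type) n (r : nat -> nat)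
    (g : forall j, 'I_(r j) -> I -> 'I_(r j.+1) -> R) (x : n.-tuple I)
    (a : 'I_(r 0%N)) : r n = 1%N ->
  \sum_(f : {dffun forall k : 'I_n.+1, 'I_(r k)} | f ord0 == a)
    \prod_(j < n) g j (f (widen_ord (leqnSn n) j)) (tnth x j) (f (lift ord0 j))
  = tt_val x g a.
Proof.
elim: n r g x a => [|n IHn] r g x a rn.
  rewrite tuple0 /= big_mkcond sum_dffunS /= (bigD1 a)//= [X in _ + X]big1.
    rewrite addr0 (eq_bigr (fun=> 1)) => [|f _]; last first.
      by rewrite ffunE dcons0 eqxx big_ord0.
    rewrite sumr_const card_dep_ffun.
    by rewrite (size0nil (etrans (size_image _ _) (card_ord 0))).
  by move=> b ba; rewrite big1// => f _; rewrite ffunE dcons0 (negbTE ba).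
rewrite big_mkcond sum_dffunS /= (bigD1 a)//= [X in _ + X]big1; last first.
  by move=> b ba; rewrite big1// => f _; rewrite ffunE dcons0 (negbTE ba).
rewrite addr0; case/tupleP: x => x0 x /=.
under [RHS]eq_bigr => b _ do rewrite -(IHn (fun j => r j.+1) _ x b rn) mulr_sumr.
rewrite (exchange_big_dep xpredT)//=; apply: eq_bigr => f _.
rewrite ffunE dcons0 eqxx (big_pred1 (f ord0)); last by move=> b; rewrite eq_sym.
rewrite big_ord_recl.
set F := ([ffun k => _] : {dffun forall k : 'I_n.+2, 'I_(r k)}).
(* Values of [F] at equal positions have different dependent types; they are compared as natural
   numbers. *)
have valF (i j : 'I_n.+2) : i = j -> F i = F j :> nat by move=> ->.
have F0 : F (widen_ord (leqnSn n.+1) ord0) = a :> 'I_(r 0%N).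
  apply: ord_inj; apply: etrans (valF _ ord0 _) _; first exact: val_inj.
  by rewrite ffunE dcons0.
have FS j : F (lift ord0 j) = f j by rewrite ffunE dconsS.
have FW (j : 'I_n) : F (widen_ord (leqnSn n.+1) (lift ord0 j)) =
    f (widen_ord (leqnSn n) j) :> 'I_(r j.+1).
  apply: ord_inj; rewrite -FS; apply: valF; exact: val_inj.
clearbody F; rewrite tnth0; congr (_ * _).
  by move: F0 (FS ord0) => /= -> ->.
apply: eq_bigr => j _; rewrite tnthS.
by move: (FW j) (FS (lift ord0 j)) => /= -> ->.
Qed.

Lemma ftt_eval_tt_val (R : realType) d (r : nat -> nat) (g : ftt_cores R r)
    (x : Rn R d) (r0 : r 0%N = 1%N) : r d = 1%N ->
  ftt_eval g x = tt_val x g (cast_ord (esym r0) ord0).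
Proof.
move=> rd; rewrite -tt_val_sum//; apply: eq_bigl => f; apply/esym/eqP.
apply: ord_inj => /=; apply/eqP; rewrite -leqn0 -ltnS.
by have := ltn_ord (f ord0); rewrite [X in (_ < X)%N]r0.
Qed.

(** * Truncated exponential and separation rank *)

Definition exp_trunc (R : realType) N (s : R) : R := \sum_(n < N) s ^+ n / n`!%:R.

Section ExpTrunc.
Variable R : realType.
Implicit Types (s q : R) (N : nat).

Lemma exp_truncE N s : exp_trunc N s = series (exp_coeff s) N.
Proof. by rewrite /exp_trunc /series/= big_mkord. Qed.

Lemma exp_trunc_nd s : 0 <= s -> nondecreasing_seq (fun N => exp_trunc N s).
Proof.
move=> s0; apply/nondecreasing_seqP => N; rewrite /exp_trunc big_ord_recr/=.
by rewrite lerDl divr_ge0// exprn_ge0.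
Qed.

Lemma exp_trunc_series s : (fun N => exp_trunc N s) = series (exp_coeff s).
Proof. by apply/funext => N; rewrite exp_truncE. Qed.

Lemma cvg_exp_trunc s : cvgn (fun N => exp_trunc N s).
Proof. by rewrite exp_trunc_series; exact: is_cvg_series_exp_coeff. Qed.

Lemma lim_exp_trunc s : limn (fun N => exp_trunc N s) = expR s.
Proof. by rewrite exp_trunc_series. Qed.

Lemma exp_trunc_le N s : 0 <= s -> exp_trunc N s <= expR s.
Proof.
move=> s0; rewrite -lim_exp_trunc.
exact: (nondecreasing_cvgn_le (exp_trunc_nd s0) (@cvg_exp_trunc s)).
Qed.

Lemma norm_exp_trunc_le N s : `|exp_trunc N s| <= expR `|s|.
Proof.
apply: le_trans (exp_trunc_le N (normr_ge0 s)).
apply: (le_trans (ler_norm_sum _ _ _)); apply: ler_sum => n _.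
by rewrite normf_div normrX [X in _ / X]ger0_norm.
Qed.

(* For n >= N, 1 <= q ^ (n - N), so the tail is at most q ^ -N exp (q |s|). *)
Lemma norm_exp_tail_le M N s q : 1 <= q -> (N <= M)%N ->
  `|exp_trunc M s - exp_trunc N s| <= expR (q * `|s|) / q ^+ N.
Proof.
move=> q1 NM; have q0 : 0 < q by lra.
rewrite !exp_truncE sub_series_geq//.
apply: (le_trans (ler_norm_sum _ _ _)).
rewrite ler_pdivlMr ?exprn_gt0// mulr_suml.
apply: le_trans (exp_trunc_le M (mulr_ge0 (ltW q0) (normr_ge0 s))).
rewrite exp_truncE /series/= (@big_cat_nat _ _ _ N 0%N)//=.
apply: ler_wpDl.
  by apply: sumr_ge0 => n _; rewrite divr_ge0// exprn_ge0// mulr_ge0// ltW.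
apply: ler_sum_nat => n /andP[Nn _].
rewrite /exp_coeff/= normf_div normrX [X in _ / X]ger0_norm// exprMn.
rewrite mulrAC ler_wpM2r// mulrC ler_wpM2r ?exprn_ge0//.
exact: ler_weXn2l.
Qed.

Lemma norm_expR_sub_trunc_le N s q : 1 <= q ->
  `|expR s - exp_trunc N s| <= expR (q * `|s|) / q ^+ N.
Proof.
move=> q1; rewrite -lim_exp_trunc ler_distl; apply/andP; split.
  apply: limr_ge; first exact: cvg_exp_trunc.
  near=> M; have : (N <= M)%N by near: M; exists N.
  by move=> /(norm_exp_tail_le s q1); rewrite ler_distl => /andP[].
apply: limr_le; first exact: cvg_exp_trunc.
near=> M; have : (N <= M)%N by near: M; exists N.
by move=> /(norm_exp_tail_le s q1); rewrite ler_distl => /andP[].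
Unshelve. all: by end_near. Qed.

End ExpTrunc.

Definition sep_rank (R : pzSemiRingType) (X Y : Type) (r : nat) (F : X -> Y -> R) :=
  exists (phi : X -> 'I_r -> R) (psi : 'I_r -> Y -> R),
    forall x y, F x y = \sum_b phi x b * psi b y.

Section SepRank.
Variables (R : comPzRingType) (X Y : Type).
Implicit Types (F : X -> Y -> R).

Lemma eq_sep_rank r F F' : (forall x y, F x y = F' x y) ->
  sep_rank r F -> sep_rank r F'.
Proof. by move=> FF' [p [q h]]; exists p, q => x y; rewrite -FF' h. Qed.

Lemma sep_rankD r1 r2 F1 F2 : sep_rank r1 F1 -> sep_rank r2 F2 ->
  sep_rank (r1 + r2) (fun x y => F1 x y + F2 x y).
Proof.
move=> [p1 [q1 h1]] [p2 [q2 h2]].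
exists (fun x (b : 'I_(r1 + r2)) => match fintype.split b with inl i => p1 x i | inr i => p2 x i end).
exists (fun (b : 'I_(r1 + r2)) y => match fintype.split b with inl i => q1 i y | inr i => q2 i y end).
move=> x y; rewrite h1 h2 big_split_ord /=; congr (_ + _); apply: eq_bigr => i _.
  by rewrite (unsplitK (inl i)).
by rewrite (unsplitK (inr i)).
Qed.

Lemma sep_rank_sum n (r : nat -> nat) (F : nat -> X -> Y -> R) :
  (forall j, (j < n)%N -> sep_rank (r j) (F j)) ->
  sep_rank (\sum_(j < n) r j) (fun x y => \sum_(j < n) F j x y).
Proof.
elim: n => [|n IHn] h.
  rewrite big_ord0; exists (fun _ _ => 0), (fun _ _ => 0) => x y.
  by rewrite !big_ord0.
rewrite big_ord_recr /=.
apply: eq_sep_rank (sep_rankD (IHn _) (h n _)) => //.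
  by move=> x y; rewrite big_ord_recr.
by move=> j jn; apply: h; exact: leqW.
Qed.

Lemma sep_rankM r F (u : X -> R) (v : Y -> R) : sep_rank r F ->
  sep_rank r (fun x y => u x * v y * F x y).
Proof.
move=> [p [q h]]; exists (fun x b => u x * p x b), (fun b y => v y * q b y).
by move=> x y; rewrite h mulr_sumr; apply: eq_bigr => b _; rewrite mulrACA.
Qed.

Lemma sum_triangle (V : nmodType) (N : nat) (f : nat -> nat -> V) :
  \sum_(n < N.+1) \sum_(j < n.+1) f n j =
  \sum_(j < N.+1) \sum_(m < (N - j).+1) f (m + j)%N j.
Proof.
elim: N => [|N IHN]; first by rewrite !big_ord_recl !big_ord0.
rewrite big_ord_recr/= IHN [RHS]big_ord_recr/= [in RHS]subnn.
rewrite [X in _ + X]big_ord_recr/= addrA; congr (_ + _).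
  rewrite -big_split/=; apply: eq_bigr => j _.
  have jN : (j <= N)%N by rewrite -ltnS.
  by rewrite subSn// [RHS]big_ord_recr/= addSn subnK.
by rewrite big_ord1.
Qed.

(** The hockey-stick identity; it adds up the ranks in the induction of [sep_rank_poly]. *)
Lemma sum_binomial_diag l N :
  (\sum_(j < N.+1) 'C(N - j + l, l) = 'C(N + l.+1, l.+1))%N.
Proof.
elim: N => [|N IHN]; first by rewrite big_ord_recl big_ord0 subn0 !add0n !binn.
rewrite big_ord_recl subn0 (eq_bigr (fun j : 'I_N.+1 => 'C(N - j + l, l))).
  by rewrite IHN [in RHS]addSn binS addnC addSnnS.
by move=> j _; rewrite /= subSS.
Qed.

(** The rank counts the monomials of degree at most N in l products. Induction on [l]: after
    binomial expansion in the first product t, the coefficient of t ^ j is a polynomial of degree N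
    - j in the sum of the others, with weights [w (m + j) *+ 'C(m + j, j)]; this is why the weights
    [w] are arbitrary. *)
Lemma sep_rank_poly l N (w : nat -> R) (a : 'I_l -> X -> R) (b : 'I_l -> Y -> R) :
  sep_rank 'C(N + l, l)
    (fun x y => \sum_(n < N.+1) w n * (\sum_i a i x * b i y) ^+ n).
Proof.
elim: l N w a b => [|l IHl] N w a b.
  rewrite bin0; exists (fun _ _ => w 0%N), (fun _ _ => 1) => x y.
  rewrite big_ord1 mulr1 big_ord_recl/= expr0 mulr1 big1 ?addr0// => n _.
  by rewrite big_ord0 expr0n mulr0.
rewrite -sum_binomial_diag.
pose F j x y := a ord0 x ^+ j * b ord0 y ^+ j *
  \sum_(m < (N - j).+1) (w (m + j)%N *+ 'C(m + j, j)) *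
    (\sum_i a (lift ord0 i) x * b (lift ord0 i) y) ^+ m.
apply: (@eq_sep_rank _ (fun x y => \sum_(j < N.+1) F j x y)).
  move=> x y; rewrite /F.
  under [RHS]eq_bigr do rewrite big_ord_recl addrC exprDn mulr_sumr.
  set t := a ord0 x * b ord0 y; set u := \sum_(i < l) a (lift ord0 i) x * b (lift ord0 i) y.
  apply/esym; apply: etrans (sum_triangle N
    (fun n j => w n * (u ^+ (n - j) * t ^+ j *+ 'C(n, j)))) _.
  apply: eq_bigr => j _; rewrite mulr_sumr; apply: eq_bigr => m _.
  rewrite addnK exprMn -[_ *+ _]mulr_natr -[w _ *+ _]mulr_natr; ring.
apply: (@sep_rank_sum N.+1 (fun j => 'C(N - j + l, l)) F) => j _.
exact: (sep_rankM (fun x => a ord0 x ^+ j) (fun y => b ord0 y ^+ j)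
  (IHl (N - j)%N (fun m => w (m + j)%N *+ 'C(m + j, j)) _ _)).
Qed.

End SepRank.

(** * Upper bounds for binomial coefficients *)

Section BinomialBound.
Variable R : realType.

Lemma binomial_prod l N :
  'C(N + l, l)%:R = \prod_(j < l) (1 + N%:R / j.+1%:R) :> R.
Proof.
elim: l => [|l IHl]; first by rewrite bin0 big_ord0.
rewrite big_ord_recr/= -IHl; have l0 : l.+1%:R != 0 :> R by rewrite pnatr_eq0.
apply: (mulIf l0); rewrite -natrM mulnC -mul_bin_diag/= addnS /= natrM.
rewrite -mulrA mulrC; congr (_ * _); rewrite mulrDl mul1r divfK//.
by rewrite -addnS natrD addrC.
Qed.

(** The increment 1 / (l + 1) is at most ln ((l + 1) / l), by ln (1 + x) <= x at x = - 1 / (l +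
    1). *)
Lemma harmonic_le_ln l : (0 < l)%N ->
  \sum_(j < l) j.+1%:R^-1 <= 1 + ln (l%:R) :> R.
Proof.
elim: l => // -[|l] IHl _; first by rewrite big_ord_recr big_ord0/= ln1 add0r addr0 invr1.
rewrite big_ord_recr/= (le_trans (lerD (IHl isT) (lexx _)))//.
have l1 : 0 < l.+1%:R :> R by rewrite ltr0n.
have l2 : 0 < l.+2%:R :> R by rewrite ltr0n.
rewrite -addrA lerD2l -lerBrDl -ln_div ?posrE//.
rewrite -[leRHS]opprK -lnV ?posrE ?divr_gt0// lerNr invf_div.
have -> : l.+1%:R / l.+2%:R = 1 + (- l.+2%:R^-1) :> R.
  have l2E : l.+2%:R = l.+1%:R + 1 :> R by rewrite natr1.
  by apply: (mulIf (lt0r_neq0 l2)); rewrite divfK ?gt_eqF// mulrDl mulNr mulVf ?gt_eqF// l2E; ring.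
by apply: le_ln1Dx; rewrite ltrN2 invf_lt1// ltr1n.
Qed.

(* AM-GM applied to the factors [1 + N / j], 1 <= j <= l. *)
Lemma binomial_le_exp l N : (0 < l)%N ->
  'C(N + l, l)%:R <= (1 + N%:R * (1 + ln l%:R) / l%:R) ^+ l :> R.
Proof.
move=> l0; have lR : 0 < l%:R :> R by rewrite ltr0n.
rewrite binomial_prod.
have := @leif_AGM R _ predT (fun j : 'I_l => 1 + N%:R / j.+1%:R).
rewrite card_ord => /(_ _)[|+ _]; first by move=> j _; rewrite addr_ge0// divr_ge0.
move=> /le_trans; apply.
have s0 : 0 <= \sum_(j < l) j.+1%:R^-1 :> R by apply: sumr_ge0 => j _; rewrite invr_ge0.
rewrite big_split/= sumr_const card_ord -mulr_sumr mulrDl divff ?gt_eqF//.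
apply: lerXn2r; rewrite ?nnegrE.
- by rewrite addr_ge0// divr_ge0// mulr_ge0.
- by rewrite addr_ge0// divr_ge0// mulr_ge0// (le_trans s0)// harmonic_le_ln.
- by rewrite lerD2l ler_pM2r ?invr_gt0// ler_wpM2l// harmonic_le_ln.
Qed.

End BinomialBound.

(** * Bounds from eigenvalues and singular values *)

Section SymmetricForms.
Variables (R : realType).
Local Open Scope sesquilinear_scope.

(** The matrix is complexified and diagonalized as a hermitian matrix. Its eigenvalues are real and
    are roots of the same characteristic polynomial, hence eigenvalues of [M] over the reals, so
    each is at most [b]. *)
Lemma sym_form_le n (M : 'M[R]_n) (b : R) : M^T = M ->
  (forall a, eigenvalue M a -> a <= b) ->
  forall v : 'cV_n, (v^T *m M *m v) 0 0 <= b * sqn v.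
Proof.
move=> Msym Meig v; pose f := real_complex R.
pose MC := map_mx f M; pose vC := map_mx f v.
have realf (x : R) : f x \is Num.real.
  by rewrite realE -(rmorph0 f) /f !lecR -realE num_real.
have hMC : MC \is hermsymmx.
  apply: realsym_hermsym; last by apply/mxOverP => i j; rewrite mxE.
  by apply/is_hermitianmxP; rewrite expr0 scale1r map_mx_id// map_trmx Msym.
pose P := spectralmx MC; pose D := spectral_diag MC.
have Pu : P \is unitarymx := spectral_unitarymx MC.
have MCE : MC = invmx P *m diag_mx D *m P.
  exact/orthomx_spectralP/hermitian_normalmx.
have Dreal i : D 0 i \is Num.real.
  by have /mxOverP := hermitian_spectral_diag_real hMC; apply.
have Punit : P \in unitmx := unitarymx_unit Pu.
clearbody P D.
have PM : P *m MC = diag_mx D *m P.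
  by rewrite MCE -!mulmxA (mulKVmx Punit).
have Dle i : D 0 i <= f b.
  have Dif : D 0 i = f (complex.Re (D 0 i)) by rewrite /f RRe_real.
  rewrite Dif lecR; apply: Meig.
  rewrite eigenvalue_root_char -(fmorph_root f) map_char_poly.
  rewrite [X in root _ X](_ : _ = D 0 i); last exact: esym Dif.
  rewrite -eigenvalue_root_char; apply/eigenvalueP; exists (row i P).
    rewrite -row_mul [X in row i X]PM.
    by rewrite row_mul row_diag_mx -scalemxAl -rowE.
  apply/negP => /eqP /(congr1 (mulmx^~ (P^t*)))/=; rewrite -row_mul.
  move/unitarymxP: (Pu) => ->; rewrite mul0mx => /matrixP /(_ 0 i).
  by rewrite !mxE eqxx => /eqP; rewrite oner_eq0.
pose w := P *m vC.
have vCt : vC^t* = vC^T.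
  by apply/matrixP => i j; rewrite !mxE; apply/CrealP/realf.
have wt : w^t* = vC^T *m P^t* by rewrite trmx_mul map_mxM vCt.
rewrite -lecR rmorphM/= -/(f _) -/(f b) -/(f (sqn v)).
have -> : f ((v^T *m M *m v) 0 0) = \sum_i D 0 i * `|w i 0| ^+ 2.
  have -> : f ((v^T *m M *m v) 0 0) = (vC^T *m MC *m vC) 0 0.
    by rewrite /vC /MC map_trmx -!map_mxM [RHS]mxE.
  rewrite MCE invmx_unitary// !mulmxA -wt -mulmxA -/w mxE.
  apply: eq_bigr => i _; rewrite mul_mx_diag !mxE normCK; ring.
have -> : f (sqn v) = \sum_i `|w i 0| ^+ 2.
  have -> : f (sqn v) = (vC^T *m vC) 0 0 by rewrite /vC map_trmx -map_mxM [RHS]mxE.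
  have -> : vC^T *m vC = w^t* *m w.
    by rewrite wt -(invmx_unitary Pu) -mulmxA (mulKmx Punit).
  rewrite mxE; apply: eq_bigr => i _; rewrite !mxE normCK; ring.
rewrite mulr_sumr; apply: ler_sum => i _; exact: ler_wpM2r.
Qed.

Lemma sym_form_ge n (M : 'M[R]_n) (b : R) : M^T = M ->
  (forall a, eigenvalue M a -> b <= a) ->
  forall v : 'cV_n, b * sqn v <= (v^T *m M *m v) 0 0.
Proof.
move=> Msym Meig v; rewrite -lerN2 -mulNr.
have -> : - (v^T *m M *m v) 0 0 = (v^T *m - M *m v) 0 0.
  by rewrite mulmxN mulNmx [RHS]mxE.
apply: sym_form_le => [|a /eigenvalueP[u uM u0]]; first by rewrite linearN/= Msym.
rewrite lerNr; apply: Meig; apply/eigenvalueP; exists u => //.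
by apply: oppr_inj; rewrite -mulmxN uM scaleNr opprK.
Qed.

Lemma singular_values_norm_le m n (A : 'M[R]_(m, n)) (s : seq R) :
  singular_values A s -> forall v : 'cV_n, sqn (A *m v) <= (nth 0 s 0) ^+ 2 * sqn v.
Proof.
move=> [ssort s0 chi] v.
have -> : sqn (A *m v) = (v^T *m (A^T *m A) *m v) 0 0.
  by rewrite /sqn trmx_mul !mulmxA.
apply: sym_form_le => [|a]; first by rewrite trmx_mul trmxK.
rewrite eigenvalue_root_char chi => h.
have /hasP[x xs] : has (fun x => a == x ^+ 2) s.
  elim: s {ssort s0 chi} h => [|x s IHs] /=; first by rewrite big_nil rootC oner_eq0.
  by rewrite big_cons rootM root_XsubC => /orP[->//|/IHs ->]; rewrite orbT.
move=> /eqP ->; have x0 : 0 <= x by exact: (allP s0).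
case: s ssort {s0 chi h} xs => // y s /= ys; rewrite inE => /orP[/eqP ->//|xs].
have xy : x <= y.
  have trans : transitive (fun x y : R => y <= x) by move=> ? ? ? /[swap]; exact: le_trans.
  by move: ys; rewrite path_sortedE// => /andP[/allP /(_ _ xs)].
by rewrite ler_sqr ?nnegrE// (le_trans x0).
Qed.

End SymmetricForms.

(** * Integration over R^n *)

Section LebesgueRnIntegral.
Variable R : realType.
Local Notation leb := (@lebesgue_measure R).

Lemma sigma_finite_lebesgue_Rn n : sigma_finite [set: Rn R n] (lebesgue_Rn R n).
Proof.
pose F (k : nat) : set (Rn R n) :=
  [set t | forall i, (`[(- k%:R), k%:R]%classic : set (measurableTypeR R)) (tnth t i)].
exists F; last first.
  move=> k; split; last first.
    rewrite (lebesgue_Rn_box (A := fun=> `[(- k%:R), k%:R]%classic))//.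
    rewrite big_const_ord; elim: n {F} => [|n IHn]; first by rewrite /= ltry.
    by rewrite iterS; apply: lte_mul_pinfty => //;
      rewrite lebesgue_measure_itv//=; case: ifP => // _; rewrite -EFinB.
  have -> : F k = \bigcap_(i in [set: 'I_n])
      ((fun t : Rn R n => tnth t i) @^-1` `[(- k%:R), k%:R]%classic).
    by apply/seteqP; split=> t /= h i; [move=> _; exact: h|exact: h].
  apply: fin_bigcap_measurable; first exact: finite_finset.
  by move=> i _; rewrite -[X in measurable X]setTI; exact: measurable_tnth.
apply/seteqP; split=> // t _.
exists (Num.truncn (\sum_i `|tnth t i : R|)).+1 => // i /=.
rewrite in_itv/= -ler_norml; apply: ltW; apply: le_lt_trans (truncnS_gt _).
by rewrite (bigD1 i)//= lerDl sumr_ge0.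
Qed.

(** A second name for the measure as a function, to carry the sigma-finite structure that the
    Fubini-Tonelli theorem asks for. *)
Definition lebesgue_Rn_sf n : set (Rn R n) -> \bar R := lebesgue_Rn R n.

HB.instance Definition _ n := isMeasure.Build _ _ _ (@lebesgue_Rn_sf n)
  (measure0 (lebesgue_Rn R n)) (measure_ge0 (lebesgue_Rn R n))
  (@measure_semi_sigma_additive _ _ _ (lebesgue_Rn R n)).

HB.instance Definition _ n := Measure_isSigmaFinite.Build _ _ _
  (@lebesgue_Rn_sf n) (@sigma_finite_lebesgue_Rn n).

Lemma integral_lebesgue_RnS n (f : Rn R n.+1 -> \bar R) :
  measurable_fun [set: Rn R n.+1] f -> (forall t, 0 <= f t)%E ->
  (\int[lebesgue_Rn R n.+1]_t f t =
   \int[lebesgue_Rn R n]_t \int[leb]_x f (tcons (x, t)))%E.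
Proof.
move=> mf f0.
have /esym := ge0_integral_pushforward (@measurable_tcons R n)
  (leb \x^ lebesgue_Rn R n)%E measurableT mf (fun t _ => f0 t).
rewrite preimage_setT => pushE.
transitivity (\int[(leb \x^ lebesgue_Rn R n)%E]_p f (tcons p))%E.
  rewrite pushE; apply: eq_measure_integral; first exact: measurable_tcons.
  by move=> *.
have mft : measurable_fun [set: (measurableTypeR R * Rn R n)%type] (f \o @tcons R n).
  by apply: measurableT_comp => //; exact: measurable_tcons.
rewrite -[RHS](fubini_tonelli2 (m1 := leb) (m2 := @lebesgue_Rn_sf n) _ mft (fun p => f0 (tcons p))).
(* The product measure inside [lebesgue_Rn] and the one of Tonelli's theorem agree, since they agree
   on rectangles. *)
apply: eq_measure_integral => A mA _; apply/esym.
by apply: product_measure_unique => // X Y mX mY; exact: product_measure2E.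
Qed.

Lemma swap_lebesgue_Rn n (f : R -> Rn R n -> \bar R) :
  measurable_fun [set: (measurableTypeR R * Rn R n)%type] (fun p => f p.1 p.2) ->
  (forall x t, 0 <= f x t)%E ->
  (\int[lebesgue_Rn R n]_t \int[leb]_x f x t =
   \int[leb]_x \int[lebesgue_Rn R n]_t f x t)%E.
Proof.
move=> mf f0; apply/esym.
exact: (fubini_tonelli (m1 := leb) (m2 := @lebesgue_Rn_sf n) _ mf (fun p => f0 p.1 p.2)).
Qed.

Lemma measurable_integral_leb n (f : R -> Rn R n -> \bar R) :
  measurable_fun [set: (measurableTypeR R * Rn R n)%type] (fun p => f p.1 p.2) ->
  (forall x t, 0 <= f x t)%E ->
  measurable_fun [set: Rn R n] (fun t => \int[leb]_x f x t)%E.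
Proof.
move=> mf f0.
exact: (measurable_fun_fubini_tonelli_G (m1 := leb) _ mf (fun p => f0 p.1 p.2)).
Qed.

Definition coordmap n (h : 'I_n -> R -> R) (t : Rn R n) : Rn R n :=
  [tuple h i (tnth t i) | i < n].

Definition leb_preserving (h : R -> R) :=
  measurable_fun [set: measurableTypeR R] (h : _ -> measurableTypeR R) /\
  forall A, measurable A -> leb (h @^-1` A) = leb A.

Lemma measurable_coordmap n (h : 'I_n -> R -> R) :
  (forall i, measurable_fun [set: measurableTypeR R] (h i : _ -> measurableTypeR R)) ->
  measurable_fun [set: Rn R n] (coordmap h).
Proof.
move=> mh; apply/measurable_fun_tnthP => i.
rewrite (_ : _ \o _ = h i \o (fun t : Rn R n => tnth t i)).
  by apply: (measurableT_comp (mh i)); exact: measurable_tnth.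
by apply/funext => t /=; rewrite tnth_mktuple.
Qed.

Lemma coordmap_tcons n (h : 'I_n.+1 -> R -> R) x (t : Rn R n) :
  coordmap h (tcons (x, t)) =
  tcons (h ord0 x, coordmap (fun i => h (lift ord0 i)) t).
Proof.
apply: eq_from_tnth => i; rewrite tnth_mktuple.
by case: (unliftP ord0 i) => [j|] ->; rewrite ?tnthS ?tnth0 ?tnth_mktuple.
Qed.

Lemma integral_leb_preserving (h : R -> R) (f : R -> \bar R) :
  leb_preserving h -> measurable_fun [set: R] f -> (forall x, 0 <= f x)%E ->
  (\int[leb]_x f (h x) = \int[leb]_x f x)%E.
Proof.
move=> [mh lh] mf f0.
have := ge0_integral_pushforward mh leb measurableT mf (fun t _ => f0 t).
rewrite preimage_setT => <-.
by apply: eq_measure_integral => // A mA _; exact: lh.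
Qed.

(** The only change of variables in the proof: it serves for translations, which complete squares,
    and for sign changes, which reverse the cross term at a cut. *)
Lemma integral_coordmap n (h : 'I_n -> R -> R) (f : Rn R n -> \bar R) :
  (forall i, leb_preserving (h i)) ->
  measurable_fun [set: Rn R n] f -> (forall t, 0 <= f t)%E ->
  (\int[lebesgue_Rn R n]_t f (coordmap h t) = \int[lebesgue_Rn R n]_t f t)%E.
Proof.
elim: n h f => [|n IHn] h f hh mf f0.
  by apply: eq_integral => t _; rewrite [t]tuple0 [coordmap _ _]tuple0.
have mft : measurable_fun [set: (measurableTypeR R * Rn R n)%type] (f \o @tcons R n).
  by apply: measurableT_comp => //; exact: measurable_tcons.
rewrite !integral_lebesgue_RnS//; last first.
  by apply: measurableT_comp => //; apply: measurable_coordmap => i; case: (hh i).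
rewrite -(IHn (fun i => h (lift ord0 i)) (fun t => \int[leb]_x f (tcons (x, t)))%E)//.
- apply: eq_integral => t _.
  under eq_integral do rewrite coordmap_tcons.
  rewrite (integral_leb_preserving (f := fun x => f (tcons (x, _))) (hh ord0))//.
  by apply: (measurableT_comp mft); exact: measurable_pair2.
- exact: (measurable_integral_leb (f := fun x t => f (tcons (x, t)))).
- by move=> t; exact: integral_ge0.
Qed.

Lemma leb_preserving_add (b : R) : leb_preserving (fun x => x + b).
Proof.
have mb : measurable_fun [set: measurableTypeR R] (fun x : R => x + b : measurableTypeR R).
  exact: measurable_funD.
split=> // A mA.
rewrite -/(pushforward leb (fun x : R => x + b : measurableTypeR R) A).
apply/esym/lebesgue_measure_unique => //= _ [[a c]] _ <-; rewrite /pushforward.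
rewrite (_ : _ @^-1` _ = `](a - b), (c - b)]%classic); last first.
  by apply/seteqP; split=> x /=; rewrite !in_itv/= ltrBlDr lerBrDr.
by rewrite !lebesgue_measure_itv/= !lte_fin ltrD2r -!EFinB opprB addrA subrK.
Qed.

Lemma leb_preserving_opp : leb_preserving (@GRing.opp R).
Proof.
split; first exact: oppr_measurable.
by move=> A mA; exact: lebesgue_measureN.
Qed.

Lemma leb_preserving_id : leb_preserving id.
Proof. by split => //; exact: measurable_id. Qed.

End LebesgueRnIntegral.

(** * Gaussian integrals *)

Section GaussianIntegrals.
Variable R : realType.
Local Notation leb := (@lebesgue_measure R).

Lemma integral_gauss1 (c m : R) : 0 < c ->
  (\int[leb]_x (expR (- (c * (x - m) ^+ 2)))%:E = (Num.sqrt (pi / c))%:E)%E.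
Proof.
move=> c0; pose s : R := Num.sqrt ((2 * c)^-1).
have c20 : 0 <= (2 * c)^-1 by rewrite invr_ge0; nra.
have s2 : s ^+ 2 *+ 2 = c^-1.
  by rewrite /s sqr_sqrtr// -mulr_natr; field; rewrite gt_eqF.
have s0 : s != 0 by rewrite /s sqrtr_eq0 -ltNge invr_gt0; nra.
have pE : normal_peak s = (Num.sqrt (pi / c))^-1.
  by rewrite /normal_peak -mulrnAl s2 mulrC.
have p0 : 0 < Num.sqrt (pi / c) by rewrite sqrtr_gt0 divr_gt0 ?pi_gt0.
have fE x : normal_fun m s x = expR (- (c * (x - m) ^+ 2)).
  by rewrite /normal_fun s2 invrK mulNr mulrC.
have := integral_normal_pdf m s.
under eq_integral => x _.
  rewrite normal_pdfE// fE EFinM; over.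
rewrite ge0_integralZl_EFin//=; last 2 first.
- apply/measurable_EFinP.
  rewrite (_ : (fun x => _) = normal_fun m s); last by apply/funext => x; rewrite fE.
  exact: measurable_normal_fun.
- by rewrite pE invr_ge0 ltW.
move=> h; rewrite -[LHS]mul1e -[1%E]/(1%:E) -(divff (lt0r_neq0 p0)) EFinM -muleA.
by move: h; rewrite pE => ->; rewrite mule1.
Qed.

Lemma measurable_expR_comp d (T : measurableType d) (f : T -> R) :
  measurable_fun [set: T] f -> measurable_fun [set: T] (fun x => expR (f x)).
Proof. by move=> mf; apply: measurableT_comp => //; exact: measurable_expR. Qed.

Definition translate n (b : 'I_n -> R) (z : Rn R n) : Rn R n :=
  coordmap (fun i x => x + b i) z.

Lemma integral_translate n (b : 'I_n -> R) (f : Rn R n -> \bar R) :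
  measurable_fun [set: Rn R n] f -> (forall t, 0 <= f t)%E ->
  (\int[lebesgue_Rn R n]_t f (translate b t) = \int[lebesgue_Rn R n]_t f t)%E.
Proof. by move=> mf f0; apply: integral_coordmap => // i; exact: leb_preserving_add. Qed.

(* [sqrt pi * exp (w ^ 2)] is the integral of [exp (- t ^ 2 + 2 t w)] in t;
   exchanging the integrals, the linear term in w is absorbed by a translation. *)
Lemma integral_gauss_rank_one n (Q w : Rn R n -> R) (b : 'I_n -> R) (p : R) :
  measurable_fun [set: Rn R n] Q -> measurable_fun [set: Rn R n] w -> p < 1 ->
  (forall z t, Q (translate (fun i => t * b i) z) = Q z + 2 * t * w z + t ^+ 2 * p) ->
  (\int[lebesgue_Rn R n]_z (expR (- (Q z - w z ^+ 2)))%:E =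
   (Num.sqrt (1 - p))^-1%:E * \int[lebesgue_Rn R n]_z (expR (- Q z))%:E)%E.
Proof.
move=> mQ mw p1 Qtr.
have sp : 0 < Num.sqrt (pi : R) by rewrite sqrtr_gt0 pi_gt0.
set I := (X in (_ = _ * X)%E).
pose f (t : R) (z : Rn R n) : \bar R := (expR (- (t ^+ 2 - 2 * t * w z + Q z)))%:E.
have mf : measurable_fun [set: (measurableTypeR R * Rn R n)%type] (fun q => f q.1 q.2).
  apply/measurable_EFinP/measurable_expR_comp/measurable_funN.
  apply: measurable_funD; last by apply: (measurableT_comp mQ); exact: measurable_snd.
  apply: measurable_funB; first by apply: measurable_funX; exact: measurable_fst.
  apply: measurable_funM; first by apply: measurable_funM => //; exact: measurable_fst.
  by apply: (measurableT_comp mw); exact: measurable_snd.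
have f0 t z : (0 <= f t z)%E by rewrite lee_fin expR_ge0.
have mE : measurable_fun [set: Rn R n] (fun z => (expR (- (Q z - w z ^+ 2)))%:E).
  by apply/measurable_EFinP/measurable_expR_comp/measurable_funN/measurable_funB => //;
    exact: measurable_funX.
have mEQ : measurable_fun [set: Rn R n] (fun z => (expR (- Q z))%:E).
  by apply/measurable_EFinP/measurable_expR_comp/measurable_funN.
have inner z : (\int[leb]_t f t z =
    (Num.sqrt (pi : R))%:E * (expR (- (Q z - w z ^+ 2)))%:E)%E.
  have <- : (\int[leb]_t ((expR (- (Q z - w z ^+ 2)))%:E *
      (expR (- (1 * (t - w z) ^+ 2)))%:E) = \int[leb]_t f t z)%E.
    by apply: eq_integral => t _; rewrite -EFinM -expRD /f; congr (expR _)%:E; ring.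
  rewrite ge0_integralZl_EFin ?expR_ge0//; last first.
    apply/measurable_EFinP/measurable_expR_comp/measurable_funN.
    by apply: measurable_funM => //; apply: measurable_funX; exact: measurable_funB.
  by rewrite integral_gauss1// divr1 muleC.
have outer t : (\int[lebesgue_Rn R n]_z f t z =
    (expR (- ((1 - p) * (t - 0) ^+ 2)))%:E * I)%E.
  rewrite -ge0_integralZl_EFin ?expR_ge0//.
  (* Translating [Q] by [- t * b] produces the linear term [- 2 * t * w z] and [t ^+ 2 * p]; the
     latter is compensated by the factor [1 - p]. *)
  pose g z := ((expR (- ((1 - p) * (t - 0) ^+ 2)))%:E * (expR (- Q z))%:E)%E.
  rewrite -(integral_translate (fun i => - t * b i) (f := g)).
  - by apply: eq_integral => z _; rewrite /g /f Qtr -EFinM -expRD; congr (expR _)%:E; ring.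
  - by apply: measurable_funeM.
  - by move=> z; rewrite /g -EFinM lee_fin mulr_ge0 ?expR_ge0.
have key : ((Num.sqrt (pi : R))%:E * \int[lebesgue_Rn R n]_z (expR (- (Q z - w z ^+ 2)))%:E =
    (Num.sqrt (pi / (1 - p)))%:E * I)%E.
  rewrite -ge0_integralZl_EFin ?(ltW sp)//.
  under eq_integral do rewrite -inner.
  rewrite (swap_lebesgue_Rn mf f0).
  under eq_integral do rewrite outer muleC.
  rewrite ge0_integralZl//; last 2 first.
  - apply/measurable_EFinP/measurable_expR_comp/measurable_funN.
    by apply: measurable_funM => //; apply: measurable_funX; exact: measurable_funB.
  - by apply: integral_ge0 => z _; rewrite lee_fin expR_ge0.
  by rewrite integral_gauss1 ?subr_gt0// muleC.
move/(congr1 (fun x => ((Num.sqrt (pi : R))^-1%:E * x)%E)): key.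
rewrite !muleA -!EFinM mulVf ?gt_eqF// mul1e => ->; congr (_%:E * _)%E.
by rewrite sqrtrM ?pi_ge0// mulKf ?gt_eqF// sqrtrV// subr_ge0 ltW.
Qed.

End GaussianIntegrals.

Definition qform (R : nzRingType) n (M : 'M[R]_n) (v : 'cV[R]_n) : R :=
  (v^T *m M *m v) 0 0.

Section QuadraticForms.
Variables (R : comNzRingType) (n : nat).
Implicit Types (M N : 'M[R]_n) (u v : 'cV[R]_n).

Lemma qformE M v : qform M v = \sum_j \sum_i v i 0 * M i j * v j 0.
Proof.
rewrite /qform mxE; apply: eq_bigr => j _; rewrite mxE mulr_suml.
by apply: eq_bigr => i _; rewrite mxE.
Qed.

Lemma qformD M N v : qform (M + N) v = qform M v + qform N v.
Proof. by rewrite /qform mulmxDr mulmxDl mxE. Qed.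

Lemma qformZ (c : R) M v : qform (c *: M) v = c * qform M v.
Proof. by rewrite /qform -scalemxAr -scalemxAl mxE. Qed.

Lemma qform_tr M v : qform M^T v = qform M v.
Proof.
rewrite /qform; transitivity ((v^T *m M *m v)^T 0 0); last by rewrite mxE.
by rewrite !trmx_mul trmxK mulmxA.
Qed.

Lemma qform_gram m (V : 'M[R]_(m, n)) v : qform (V^T *m V) v = sqn (V *m v).
Proof. by rewrite /qform /sqn trmx_mul !mulmxA. Qed.

Lemma qform_translate M u v (t : R) : M^T = M ->
  qform M (v + t *: u) =
  qform M v + t *+ 2 * (v^T *m (M *m u)) 0 0 + t ^+ 2 * qform M u.
Proof.
move=> Msym; have uv : (u^T *m M *m v) 0 0 = (v^T *m (M *m u)) 0 0.
  transitivity ((v^T *m M^T *m u)^T 0 0); last by rewrite mxE Msym mulmxA.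
  by rewrite !trmx_mul !trmxK mulmxA.
rewrite /qform [_^T]linearD/= [(t *: u)^T]linearZ/= !mulmxDl !mulmxDr.
have addE (A B : 'M[R]_1) : (A + B) 0 0 = A 0 0 + B 0 0 by rewrite mxE.
have scaleE a (A : 'M[R]_1) : (a *: A) 0 0 = a * A 0 0 by rewrite mxE.
by rewrite -!scalemxAl -!scalemxAr !addE !scaleE uv !mulmxA; ring.
Qed.

End QuadraticForms.

Lemma qform_le_sqn (R : realType) n (M : 'M[R]_n) : exists2 c : R, 0 < c &
  forall v, qform M v <= c * sqn v.
Proof.
exists (1 + \sum_j \sum_i `|M i j|).
  by rewrite ltr_pwDl// sumr_ge0// => j _; exact: sumr_ge0.
move=> v; rewrite mulrDl mul1r; apply: ler_wpDl; first exact: sqn_ge0.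
rewrite qformE mulr_suml; apply: ler_sum => j _.
rewrite mulr_suml; apply: ler_sum => i _.
apply: (le_trans (ler_norm _)); rewrite !normrM mulrAC [leLHS]mulrC.
apply: ler_wpM2l => //.
have sq k : `|v k 0| ^+ 2 <= sqn v.
  by rewrite real_normK ?num_real// sqnE (bigD1 k)//= lerDl sumr_ge0// => ? _; exact: sqr_ge0.
have := sq i; have := sq j; have := sqr_ge0 (`|v i 0| - `|v j 0|); nra.
Qed.

Section GaussianForms.
Variables (R : realType) (n : nat).
Implicit Types (M T S : 'M[R]_n).

Lemma measurable_qform M :
  measurable_fun [set: Rn R n] (fun z => qform M (colvec z)).
Proof.
rewrite (_ : (fun z => _) = (fun z : Rn R n =>
    \sum_j \sum_i (tnth z i : R) * M i j * (tnth z j : R))); last first.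
  apply/funext => z; rewrite qformE; apply: eq_bigr => j _.
  by apply: eq_bigr => i _; rewrite !mxE.
apply: measurable_sum => j; apply: measurable_sum => i.
apply: measurable_funM; last exact: measurable_tnth.
apply: measurable_funM; first exact: measurable_tnth.
exact: measurable_cst.
Qed.

Definition gauss_int M : \bar R :=
  (\int[lebesgue_Rn R n]_z (expR (- qform M (colvec z)))%:E)%E.

Lemma measurable_gauss M :
  measurable_fun [set: Rn R n] (fun z => (expR (- qform M (colvec z)))%:E).
Proof.
apply/measurable_EFinP/measurable_expR_comp/measurable_funN; exact: measurable_qform.
Qed.

Lemma gauss_int_ge0 M : (0 <= gauss_int M)%E.
Proof. by apply: integral_ge0 => z _; rewrite lee_fin expR_ge0. Qed.

Lemma le_gauss_int M T : (forall v, qform M v <= qform T v) ->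
  (gauss_int T <= gauss_int M)%E.
Proof.
move=> MT; apply: ge0_le_integral => //; try exact: measurable_gauss.
by move=> z _; rewrite lee_fin ler_expR lerN2.
Qed.

Lemma colvec_translate (u : 'cV[R]_n) t (z : Rn R n) :
  colvec (translate (fun i => t * u i 0) z) = colvec z + t *: u.
Proof. by apply/matrixP => i j; rewrite ord1 !mxE tnth_mktuple. Qed.

(** With [S = T + m^T *m m] and p = m S^-1 m^T, the ratio of the integrals is (1 - p)^(-1/2),
    obtained by translating along S^-1 m^T instead of computing determinants. *)
Lemma gauss_int_rank_one T (m : 'rV[R]_n) (theta : R) :
  T^T = T -> posdefmx T -> 0 < theta -> theta <= 1 ->
  (forall v, theta * qform (T + m^T *m m) v <= qform T v) ->
  (gauss_int T <= (Num.sqrt theta)^-1%:E * gauss_int (T + m^T *m m))%E.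
Proof.
move=> Tsym Tpos t0 t1 hT; set S := T + _.
have Ssym : S^T = S by rewrite /S [_^T]linearD/= trmx_mul trmxK Tsym.
have SE v : qform S v = qform T v + sqn (m *m v) by rewrite qformD qform_gram.
have Spos v : v != 0 -> 0 < qform S v.
  by move=> v0; rewrite SE ltr_wpDr ?sqn_ge0//; exact: Tpos.
have Sunit : S \in unitmx.
  rewrite -unitmx_tr Ssym -row_free_unit; apply/row_freeP/row_freeP.
  rewrite -kermx_eq0; apply/rowV0P => u /sub_kermxP uS.
  apply/eqP/negPn/negP => u0; have := Spos u^T.
  by rewrite -trmx0 (inj_eq trmx_inj) u0 => /(_ isT); rewrite /qform trmxK uS mul0mx mxE ltxx.
pose u := invmx S *m m^T; have Su : S *m u = m^T by rewrite mulKVmx.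
pose p := qform S u.
have pE : p = (m *m u) 0 0.
  by rewrite /p /qform -mulmxA Su -trmx_mul mxE.
have sm v : sqn (m *m v) = (m *m v) 0 0 ^+ 2 by rewrite sqnE big_ord1.
have p0 : 0 <= p.
  by rewrite /p; have [->|/Spos/ltW//] := eqVneq u 0; rewrite /qform mulmx0 mxE.
(* At [u] the form of S is p and that of T is p - p ^ 2, so the hypothesis reads theta p <= p - p ^
   2; if p = 0 the claim is [theta <= 1]. *)
have p1 : theta <= 1 - p.
  have := hT u; rewrite -/S -/p -[qform T u](addrK (sqn (m *m u))) -SE -/p sm -pE.
  nra.
have p1' : p < 1 by lra.
have mT : measurable_fun [set: Rn R n] (fun z => (m *m colvec z) 0 0).
  rewrite (_ : (fun z => _) = (fun z : Rn R n => \sum_j m 0 j * (tnth z j : R))).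
    apply: measurable_sum => j; apply: measurable_funM => //; exact: measurable_tnth.
  by apply/funext => z; rewrite mxE; apply: eq_bigr => j _; rewrite mxE.
have TE v : qform T v = qform S v - (m *m v) 0 0 ^+ 2 by rewrite SE sm addrK.
rewrite /gauss_int; under eq_integral do rewrite TE.
rewrite (integral_gauss_rank_one (b := fun i => u i 0) (p := p)
  (measurable_qform S) mT p1'); last first.
  move=> z t; rewrite colvec_translate qform_translate// Su -/p.
  have -> : ((colvec z)^T *m m^T) 0 0 = (m *m colvec z) 0 0.
    by rewrite -trmx_mul mxE.
  by rewrite -[t *+ 2]mulr_natl.
apply: lee_wpmul2r; first exact: gauss_int_ge0.
by rewrite lee_fin lef_pV2 ?posrE ?sqrtr_gt0 ?ler_sqrt//; lra.
Qed.

(** The squares of the rows of [V] are added one at a time. Every intermediate form lies between [T]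
    and [T + V^T *m V], so the same [theta] serves at each step. *)
Lemma gauss_int_low_rank T r (V : 'M[R]_(r, n)) (theta : R) :
  T^T = T -> posdefmx T -> 0 < theta -> theta <= 1 ->
  (forall v, theta * qform (T + V^T *m V) v <= qform T v) ->
  (gauss_int T <= ((Num.sqrt theta)^-1 ^+ r)%:E * gauss_int (T + V^T *m V))%E.
Proof.
move=> Tsym Tpos t0 t1.
elim: r V => [|r IHr] V hV.
  by rewrite expr0 mul1e (flatmx0 V) mulmx0 addr0.
rewrite -[r.+1]/(1 + r)%N in V hV *.
pose m := usubmx V; pose V' := dsubmx V.
have VV : V^T *m V = V'^T *m V' + m^T *m m.
  by rewrite -{1 2}[V]vsubmxK tr_col_mx mul_row_col addrC.
have E v : qform (T + V^T *m V) v = qform (T + V'^T *m V') v + sqn (m *m v).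
  by rewrite VV addrA [LHS]qformD qform_gram.
have E' v : qform (T + V'^T *m V') v = qform T v + sqn (V' *m v).
  by rewrite qformD qform_gram.
have h' v : theta * qform (T + V'^T *m V') v <= qform T v.
  apply: le_trans (hV v); apply: ler_wpM2l; first exact: ltW.
  by rewrite E lerDl sqn_ge0.
apply: (le_trans (IHr V' h')); rewrite exprSr EFinM -muleA.
apply: lee_wpmul2l; first by rewrite lee_fin exprn_ge0// invr_ge0 sqrtr_ge0.
rewrite VV addrA; apply: gauss_int_rank_one => //.
- by rewrite [_^T]linearD/= trmx_mul trmxK Tsym.
- move=> v v0; rewrite -/(qform _ v) E' ltr_wpDr ?sqn_ge0//; exact: Tpos.
- move=> v; rewrite -addrA -VV; apply: (le_trans (hV v)).
  by rewrite E' lerDl sqn_ge0.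
Qed.

End GaussianForms.

Lemma sqn_colvec (R : realType) n (z : Rn R n) : sqn (colvec z) = \sum_i (tnth z i : R) ^+ 2.
Proof. by rewrite sqnE; apply: eq_bigr => i _; rewrite mxE. Qed.

Lemma integral_expR_sqn (R : realType) n (c : R) : 0 < c ->
  (\int[lebesgue_Rn R n]_z (expR (- (c * sqn (colvec z))))%:E =
   (Num.sqrt (pi / c) ^+ n)%:E)%E.
Proof.
move=> c0.
have mf m : measurable_fun [set: Rn R m] (fun z => (expR (- (c * sqn (colvec z))))%:E).
  apply/measurable_EFinP/measurable_expR_comp/measurable_funN.
  apply: measurable_funM => //.
  rewrite (_ : (fun z => _) = (fun z : Rn R m => \sum_i (tnth z i : R) ^+ 2)).
    by apply: measurable_sum => i; apply: measurable_funX; exact: measurable_tnth.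
  by apply/funext => z; rewrite sqn_colvec.
elim: n => [|n IHn].
  rewrite /= integral_dirac//=; last exact: mf.
  by rewrite sqn_colvec big_ord0 mulr0 oppr0 expR0 expr0 mule1 diracT.
rewrite (integral_lebesgue_RnS (mf n.+1)); last by move=> z; rewrite lee_fin expR_ge0.
transitivity (\int[lebesgue_Rn R n]_t ((Num.sqrt (pi / c))%:E *
    (expR (- (c * sqn (colvec t))))%:E))%E.
  apply: eq_integral => t _; rewrite -(integral_gauss1 0 c0) muleC.
  rewrite -ge0_integralZl_EFin ?expR_ge0//; last first.
    apply/measurable_EFinP/measurable_expR_comp/measurable_funN.
    by apply: measurable_funM => //; apply: measurable_funX; exact: measurable_funB.
  apply: eq_integral => x _; rewrite -EFinM -expRD !sqn_colvec big_ord_recl tnth0.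
  rewrite (eq_bigr (fun i => (tnth t i : R) ^+ 2)) => [|i _]; last by rewrite tnthS.
  by congr (expR _)%:E; rewrite /=; ring.
rewrite exprS EFinM -IHn; apply: ge0_integralZl_EFin => //.
exact: mf.
Qed.

(** * Approximation at one cut *)

Lemma sqnN (R : nzRingType) n (v : 'cV[R]_n) : sqn (- v) = sqn v.
Proof. by rewrite !sqnE; apply: eq_bigr => i _; rewrite mxE sqrrN. Qed.

Section Cut.
Variables (R : realType) (d : nat) (k : nat).

(** The cut is described by complementary coordinate projections of R^d instead of block matrices,
    so that all vectors and forms stay in dimension d. *)
Definition lowmx : 'M[R]_d := diag_mx (\row_i (i < k)%:R).
Definition highmx : 'M[R]_d := 1%:M - lowmx.

Lemma tr_lowmx : lowmx^T = lowmx. Proof. exact: tr_diag_mx. Qed.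

Lemma tr_highmx : highmx^T = highmx.
Proof. by rewrite [_^T]linearB/= trmx1 tr_lowmx. Qed.

Lemma lowmx_idem : lowmx *m lowmx = lowmx.
Proof.
rewrite mulmx_diag; congr diag_mx; apply/rowP => i; rewrite !mxE.
by case: ltnP; rewrite ?mulr1 ?mulr0.
Qed.

Lemma high_low0 : highmx *m lowmx = 0.
Proof. by rewrite mulmxBl mul1mx lowmx_idem subrr. Qed.

Lemma low_high0 : lowmx *m highmx = 0.
Proof. by rewrite mulmxBr mulmx1 lowmx_idem subrr. Qed.

Lemma highmx_idem : highmx *m highmx = highmx.
Proof. by rewrite mulmxBr mulmx1 high_low0 subr0. Qed.

Lemma low_add_high (v : 'cV_d) : lowmx *m v + highmx *m v = v.
Proof. by rewrite -mulmxDl addrC subrK mul1mx. Qed.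

Lemma lowmxE (v : 'cV_d) i : (lowmx *m v) i 0 = if (i < k)%N then v i 0 else 0.
Proof. by rewrite mul_diag_mx !mxE; case: ltnP; rewrite ?mul1r ?mul0r. Qed.

Lemma highmxE (v : 'cV_d) i : (highmx *m v) i 0 = if (i < k)%N then 0 else v i 0.
Proof.
rewrite mulmxBl mul1mx [LHS]mxE [X in _ + X]mxE lowmxE.
by case: ifP; rewrite ?subrr ?subr0.
Qed.

Lemma sqn_low_high (v : 'cV_d) : sqn (lowmx *m v) + sqn (highmx *m v) = sqn v.
Proof.
rewrite -[in RHS](low_add_high v) sqnD_orth// trmx_mul tr_lowmx.
by rewrite -mulmxA (mulmxA lowmx) low_high0 mul0mx mulmx0.
Qed.

Lemma sqn_low_sub_high (v : 'cV_d) : sqn (lowmx *m v - highmx *m v) = sqn v.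
Proof.
rewrite -(sqn_low_high v) sqnD_orth ?sqnN//.
rewrite trmx_mul tr_lowmx mulmxN.
by rewrite -mulmxA (mulmxA lowmx) low_high0 mul0mx mulmx0 oppr0.
Qed.

Variable G : 'M[R]_d.
Hypothesis Gsym : G^T = G.

Definition cutmx : 'M[R]_d := highmx *m G *m lowmx.

Definition cutform (x y : 'cV[R]_d) : R := (y^T *m G *m x) 0 0.

Lemma qformD_cut (x y : 'cV_d) :
  qform G (x + y) = qform G x + qform G y + 2 * cutform x y.
Proof.
have := qform_translate y x 1 Gsym; rewrite scale1r => ->.
have -> : (x^T *m (G *m y)) 0 0 = cutform x y.
  rewrite /cutform -[in RHS]Gsym; transitivity ((x^T *m (G *m y))^T 0 0); first by rewrite [RHS]mxE.
  by rewrite !trmx_mul trmxK.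
by rewrite mulr2n expr1n; ring.
Qed.

Lemma qformB_cut (x y : 'cV_d) :
  qform G (x - y) = qform G x + qform G y - 2 * cutform x y.
Proof.
rewrite qformD_cut /cutform /qform [(- y)^T]linearN/= !mulNmx mulmxN opprK.
by rewrite [X in 2 * X]mxE mulrN.
Qed.

Lemma cutmx_form (v : 'cV_d) :
  qform cutmx v = cutform (lowmx *m v) (highmx *m v).
Proof. by rewrite /qform /cutform /cutmx trmx_mul tr_highmx !mulmxA. Qed.

Lemma qform_cut (v : 'cV_d) : qform G v =
  qform G (lowmx *m v) + qform G (highmx *m v) + 2 * qform cutmx v.
Proof. by rewrite cutmx_form -qformD_cut low_add_high. Qed.

(** Gram-Schmidt on a basis of the column space, so that [V] has exactly [\rank cutmx] rows. This
    number becomes both the number of products in the cross term and the exponent of sqrt 2. *)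
Lemma col_gram_schmidt : exists V : 'M[R]_(\rank cutmx, d),
  V *m V^T *m V = V /\ V^T *m V *m cutmx = cutmx.
Proof.
rewrite -mxrank_tr.
have [V [VV MV]] := gram_schmidt (row_base cutmx^T); exists V; split => //.
have /submxP[X XE] : (cutmx^T <= row_base cutmx^T)%MS by rewrite eq_row_base.
apply: trmx_inj; rewrite trmx_mul [(V^T *m V)^T]trmx_mul trmxK mulmxA.
have := congr1 (fun Y => Y *m V^T *m V) XE => /= ->.
rewrite -[X *m _ *m _]mulmxA -[X *m _ *m _]mulmxA.
by rewrite MV -XE.
Qed.

Variables (lam sig : R).
Hypotheses (lam0 : 0 < lam) (sig0 : 0 < sig).
Hypothesis Glam : forall v, lam * sqn v <= qform G v.
Hypothesis Gsig : forall v, sqn (cutmx *m v) <= sig ^+ 2 * sqn (lowmx *m v).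

(* [stretch] is G with its off-diagonal blocks multiplied by 1 + lam / (2 sig);
   adding the Gram matrix of W makes it dominate G. *)
Let c := lam / sig / 2.
Let stretch : 'M[R]_d := G + c *: (cutmx + cutmx^T).

Lemma gauss_int_stretch :
  (gauss_int stretch <= (Num.sqrt 2 ^+ \rank cutmx)%:E * gauss_int G)%E.
Proof.
have [V [VV VA]] := col_gram_schmidt.
pose b : R := Num.sqrt lam / 2.
have b2 : b ^+ 2 = lam / 4 by rewrite /b expr_div_n sqr_sqrtr ?ltW//; field.
(* The cross term of [|W v|^2] is minus half of what [stretch] adds to G. The other half is at least
   minus the two square terms of [|W v|^2], so that [stretch + W^T *m W] dominates G. *)
pose W : 'M[R]_(\rank cutmx, d) := b *: (V *m highmx - sig^-1 *: (V *m cutmx)).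
have stretchE v : qform stretch v = qform G v + 2 * c * qform cutmx v.
  by rewrite qformD qformZ qformD qform_tr; ring.
pose a1 v := sqn (V *m highmx *m v); pose a2 v := sqn (V *m cutmx *m v).
have a1_le v : a1 v <= sqn (highmx *m v) by rewrite /a1 -mulmxA; exact: sqn_pisom.
have a2_le v : a2 v <= sig ^+ 2 * sqn (lowmx *m v).
  by rewrite /a2 -mulmxA (le_trans (sqn_pisom VV _)).
have cross v : qform cutmx v = ((V *m highmx *m v)^T *m (V *m cutmx *m v)) 0 0.
  rewrite !trmx_mul tr_highmx !mulmxA /qform; congr (_ 0 0).
  rewrite -{1}[cutmx](_ : highmx *m cutmx = _); last by rewrite /cutmx !mulmxA highmx_idem.
  by rewrite -{1}VA !mulmxA.
have WE v : sqn (W *m v) = lam / 4 * (a1 v + a2 v / sig ^+ 2 - 2 / sig * qform cutmx v).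
  rewrite /W -scalemxAl mulmxBl -scalemxAl.
  have sqnZ (t : R) (u : 'cV[R]_(\rank cutmx)) : sqn (t *: u) = t ^+ 2 * sqn u.
    by rewrite !sqnE mulr_sumr; apply: eq_bigr => i _; rewrite mxE; ring.
  rewrite sqnZ b2; congr (_ * _); rewrite cross /a1 /a2.
  set x := V *m highmx *m v; set y := V *m cutmx *m v.
  have -> : (x^T *m y) 0 0 = \sum_i x i 0 * y i 0.
    by rewrite mxE; apply: eq_bigr => i _; rewrite mxE.
  rewrite !sqnE mulr_suml mulr_sumr -big_split/= -sumrB; apply: eq_bigr => i _.
  by rewrite !mxE; field; rewrite gt_eqF.
have cs : 2 * c = lam / sig by rewrite /c; field; rewrite gt_eqF.
have sqnv v := sqn_low_high v.
have a2d v : a2 v / sig ^+ 2 <= sqn (lowmx *m v).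
  by rewrite ler_pdivrMr ?exprn_gt0// mulrC.
(* Cauchy-Schwarz with weights, from the squared norms of [sig x + y] and [sig x - y] being
   nonnegative. *)
have mix v : `|2 / sig * qform cutmx v| <= a1 v + a2 v / sig ^+ 2.
  have := sqn_ge0 (sig *: (V *m highmx *m v) + V *m cutmx *m v).
  have := sqn_ge0 (sig *: (V *m highmx *m v) - V *m cutmx *m v).
  have sq (x y : 'cV[R]_(\rank cutmx)) (e := (x^T *m y) 0 0) :
      sqn (sig *: x + y) = sig ^+ 2 * sqn x + sqn y + 2 * sig * e /\
      sqn (sig *: x - y) = sig ^+ 2 * sqn x + sqn y - 2 * sig * e.
    have -> : e = \sum_i x i 0 * y i 0.
      by rewrite /e mxE; apply: eq_bigr => i _; rewrite mxE.
    rewrite !sqnE !mulr_sumr -!big_split/= -sumrB.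
    by split; apply: eq_bigr => i _; rewrite !mxE; ring.
  have [-> ->] := sq (V *m highmx *m v) (V *m cutmx *m v).
  rewrite -cross -/(a1 v) -/(a2 v).
  move=> h1 h2; rewrite ler_norml.
  have sig2 : 0 < sig ^+ 2 by rewrite exprn_gt0.
  have e : 2 / sig * qform cutmx v = (2 * sig * qform cutmx v) / sig ^+ 2.
    by field; rewrite gt_eqF.
  have e' : a1 v + a2 v / sig ^+ 2 = (sig ^+ 2 * a1 v + a2 v) / sig ^+ 2.
    by field; rewrite gt_eqF.
  rewrite e e' -mulNr !ler_pM2r ?invr_gt0//; apply/andP; split; lra.
have W_le v : sqn (W *m v) <= lam / 2 * sqn v.
  have := mix v; rewrite ler_norml => /andP[h1 h2]; rewrite WE.
  have := a1_le v; have := a2d v; have := sqnv v; nra.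
have stretch_ge v : lam / 2 * sqn v <= qform stretch v.
  rewrite stretchE cs; have := mix v; rewrite ler_norml => /andP[h1 h2].
  have -> : lam / sig * qform cutmx v = lam / 2 * (2 / sig * qform cutmx v).
    by field; rewrite gt_eqF.
  have := Glam v; have := a1_le v; have := a2d v; have := sqnv v; nra.
have sumE v : qform (stretch + W^T *m W) v = qform stretch v + sqn (W *m v).
  by rewrite qformD qform_gram.
have sum_ge v : qform G v <= qform (stretch + W^T *m W) v.
  rewrite sumE stretchE WE cs; have := mix v; rewrite ler_norml => /andP[h1 h2].
  have -> : lam / sig * qform cutmx v = lam / 2 * (2 / sig * qform cutmx v).
    by field; rewrite gt_eqF.
  nra.
have ssym : stretch^T = stretch.
  rewrite [LHS]linearD/= Gsym; congr (_ + _).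
  by rewrite [LHS]linearZ/= [X in c *: X]linearD/= trmxK addrC.
have spos : posdefmx stretch.
  move=> v v0; rewrite -/(qform _ v) (lt_le_trans _ (stretch_ge v))//.
  by rewrite mulr_gt0 ?divr_gt0// lt_def sqn_ge0 sqn_eq0 v0.
(* The value lam / 2 bounds the form of [W^T *m W] from above and that of [stretch] from below,
   relative to [sqn v]. Hence theta = 1/2, and each row of [W] costs a factor sqrt 2. *)
have half v : 2^-1 * qform (stretch + W^T *m W) v <= qform stretch v.
  by rewrite sumE; have := W_le v; have := stretch_ge v; lra.
have sE : (Num.sqrt (2^-1 : R))^-1 = Num.sqrt 2.
  by rewrite sqrtrV ?invrK ?ler0n.
have h0 : 0 < 2^-1 :> R by rewrite invr_gt0.
have h1 : 2^-1 <= 1 :> R by rewrite invf_le1// ler1n.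
apply: (le_trans (gauss_int_low_rank ssym spos h0 h1 half)).
rewrite sE; apply: lee_wpmul2l.
  by rewrite lee_fin exprn_ge0// sqrtr_ge0.
exact: le_gauss_int.
Qed.

End Cut.

(** Changing the sign of the variables from position k on reverses the cross term of a quadratic
    form and preserves Lebesgue measure. *)
Lemma integral_reflect (R : realType) d k (f : 'cV[R]_d -> \bar R) :
  measurable_fun [set: Rn R d] (fun z => f (colvec z)) ->
  (forall v, 0 <= f v)%E ->
  (\int[lebesgue_Rn R d]_z f (lowmx R d k *m colvec z - highmx R d k *m colvec z)%R =
   \int[lebesgue_Rn R d]_z f (colvec z))%E.
Proof.
move=> mf f0.
pose h (i : 'I_d) (x : R) := if (i < k)%N then x else - x.
have hh i : leb_preserving (h i).
  rewrite /h; case: (i < k)%N; first exact: leb_preserving_id.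
  exact: leb_preserving_opp.
rewrite -(integral_coordmap (f := fun z => f (colvec z)) hh)//.
apply: eq_integral => z _; congr f; apply/matrixP => i j; rewrite ord1.
rewrite [LHS]mxE [X in _ + X]mxE lowmxE highmxE [RHS]mxE tnth_mktuple /h mxE.
by case: (i < k)%N; rewrite ?subr0 ?sub0r.
Qed.

Section CutApproximation.
Variables (R : realType) (d k : nat) (G : 'M[R]_d).
Hypothesis Gsym : G^T = G.
Local Notation low := (lowmx R d k).
Local Notation high := (highmx R d k).
Local Notation A := (cutmx k G).

(** Two arguments make the separation of variables expressible: [x] is read only below position k
    and [y] only from k on. The approximation of the Gaussian is the diagonal [x = y]. *)
Definition cut_approx N (x y : 'cV[R]_d) : R :=
  expR (- (2^-1) * (qform G (low *m x) + qform G (high *m y))) *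
  exp_trunc N (- cutform G (low *m x) (high *m y)).

(** [exp_trunc N.+1] has degree N, whence N and not N + 1 in the binomial. The cross term is a sum
    of [\rank A] products because [V^T *m V] can be inserted in front of A. *)
Lemma cut_approx_sep N :
  sep_rank 'C(N + \rank A, \rank A) (cut_approx N.+1).
Proof.
have [V [VV VA]] := col_gram_schmidt k G.
pose a i (x : 'cV[R]_d) := (V *m A *m x) i 0.
pose b i (y : 'cV[R]_d) := - (V *m (high *m y)) i 0.
have formE x y : - cutform G (low *m x) (high *m y) = \sum_i a i x * b i y.
  have -> : cutform G (low *m x) (high *m y) = ((V *m (high *m y))^T *m (V *m A *m x)) 0 0.
    rewrite [(V *m _)^T]trmx_mul -[(high *m y)^T *m _ *m _]mulmxA !(mulmxA V^T) VA /cutform /cutmx.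
    by rewrite trmx_mul tr_highmx !mulmxA -[y^T *m high *m high]mulmxA highmx_idem.
  by rewrite mxE -sumrN; apply: eq_bigr => i _; rewrite mxE /a /b mulrN mulrC.
have := sep_rank_poly N (fun n => (n`!%:R)^-1) a b.
move=> /(sep_rankM (fun x => expR (- (2^-1) * qform G (low *m x)))
                   (fun y => expR (- (2^-1) * qform G (high *m y)))).
apply: eq_sep_rank => x y; rewrite /cut_approx formE -expRD -mulrDr; congr (_ * _).
by apply: eq_bigr => n _; rewrite mulrC.
Qed.

Lemma gaussian_cut v :
  expR (- (2^-1) * qform G v) =
  expR (- (2^-1) * (qform G (low *m v) + qform G (high *m v))) *
  expR (- cutform G (low *m v) (high *m v)).
Proof.
by rewrite -expRD (qform_cut k Gsym) cutmx_form; congr expR; field.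
Qed.

Lemma cut_approx_rank0 v : A = 0 -> cut_approx 1 v v = expR (- (2^-1) * qform G v).
Proof.
move=> A0; rewrite gaussian_cut /cut_approx -cutmx_form A0.
have -> : qform (0 : 'M[R]_d) v = 0 by rewrite /qform mulmx0 mul0mx mxE.
by rewrite oppr0 expR0 /exp_trunc big_ord1 expr0 divr1.
Qed.

Variable lam : R.
Hypothesis lam0 : 0 < lam.
Hypothesis Glam : forall v, lam * sqn v <= qform G v.

(** The truncated exponential of s is at most exp |s|, and the lower bound on G at [low v + high v]
    and at [low v - high v] covers both signs of s. This bound, uniform in N, supplies the majorant
    for the limit of fine grids. *)
Lemma cut_approx_le N v : `|cut_approx N v v| <= expR (- (lam / 2 * sqn v)).
Proof.
rewrite /cut_approx normrM ger0_norm ?expR_ge0//.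
apply: (le_trans (ler_wpM2l (expR_ge0 _) (norm_exp_trunc_le _ _))).
rewrite -expRD ler_expR normrN.
have h1 := Glam (low *m v + high *m v); have h2 := Glam (low *m v - high *m v).
rewrite low_add_high (qform_cut k Gsym) cutmx_form in h1.
rewrite sqn_low_sub_high (qformB_cut Gsym) in h2.
by case: (ger0P (cutform G (low *m v) (high *m v))) => _; lra.
Qed.

Lemma measurable_mulmx_colvec (P : 'M[R]_d) (M : 'M[R]_d) :
  measurable_fun [set: Rn R d] (fun z => qform M (P *m colvec z)).
Proof.
rewrite (_ : (fun z => _) = (fun z : Rn R d => qform (P^T *m M *m P) (colvec z))).
  exact: measurable_qform.
by apply/funext => z; rewrite /qform trmx_mul !mulmxA.
Qed.

Lemma measurable_cut_approx N :
  measurable_fun [set: Rn R d] (fun z => cut_approx N (colvec z) (colvec z)).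
Proof.
apply: measurable_funM.
  apply: measurable_expR_comp; apply: measurable_funM; first exact: measurable_cst.
  by apply: measurable_funD; exact: measurable_mulmx_colvec.
apply: measurable_sum => n; apply: measurable_funM; last exact: measurable_cst.
apply: measurable_funX; apply: measurable_funN.
rewrite (_ : (fun z => _) = (fun z : Rn R d => qform A (colvec z))).
  exact: measurable_qform.
by apply/funext => z; rewrite cutmx_form.
Qed.

Variable sig : R.
Hypothesis sig0 : 0 < sig.
Hypothesis Gsig : forall v, sqn (A *m v) <= sig ^+ 2 * sqn (low *m v).

(** The tail estimate produces exp (2 q |s|), bounded by exp (2 q s) + exp (- 2 q s). The two
    resulting Gaussians are exchanged by the reflection, so they have the same integral: this is the
    factor 2. *)
Lemma cut_approx_error N (q := 1 + lam / sig / 2) :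
  (\int[lebesgue_Rn R d]_z
     ((expR (- (2^-1) * qform G (colvec z)) -
       cut_approx N (colvec z) (colvec z)) ^+ 2)%:E <=
   (2 * Num.sqrt 2 ^+ \rank A / q ^+ (2 * N))%:E * gauss_int G)%E.
Proof.
have q1 : 1 <= q by rewrite /q lerDl divr_ge0// divr_ge0// ltW.
have q0 : 0 < q by lra.
pose T : 'M[R]_d := G + (lam / sig / 2) *: (A + A^T).
pose f (v : 'cV[R]_d) : \bar R := (expR (- qform T v))%:E.
have T_ge v : qform T v = qform G (low *m v) + qform G (high *m v) + 2 * q * cutform G (low *m v) (high *m v).
  by rewrite /T qformD qformZ qformD qform_tr (qform_cut k Gsym v) cutmx_form /q; ring.
have T_sub v : qform T (low *m v - high *m v) =
    qform G (low *m v) + qform G (high *m v) - 2 * q * cutform G (low *m v) (high *m v).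
  rewrite T_ge !mulmxBr !mulmxA lowmx_idem highmx_idem low_high0 high_low0.
  rewrite !mul0mx subr0 sub0r /qform /cutform [(- (high *m v))^T]linearN/=.
  by rewrite !mulNmx mulmxN opprK [X in 2 * q * X]mxE mulrN.
have mf : measurable_fun [set: Rn R d] (fun z => f (colvec z)) by exact: measurable_gauss.
have mfr : measurable_fun [set: Rn R d]
    (fun z => f (low *m colvec z - high *m colvec z)).
  apply/measurable_EFinP/measurable_expR_comp/measurable_funN.
  rewrite (_ : (fun z => _) = (fun z : Rn R d => qform T ((low - high) *m colvec z))).
    exact: measurable_mulmx_colvec.
  by apply/funext => z; rewrite [in RHS]mulmxBl.
have f0 v : (0 <= f v)%E by rewrite lee_fin expR_ge0.
have ptw v : (((expR (- (2^-1) * qform G v) - cut_approx N v v) ^+ 2)%:E <=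
    ((q ^+ (2 * N))^-1)%:E * (f v + f (low *m v - high *m v)%R))%E.
  rewrite /f -EFinD -EFinM lee_fin gaussian_cut /cut_approx -mulrBr exprMn T_ge T_sub.
  set s := cutform _ _ _; set Q := qform _ _ + qform _ _.
  have -> : expR (- (2^-1) * Q) ^+ 2 = expR (- Q).
    by rewrite -expRM_natl; congr expR; field.
  have tail : (expR (- s) - exp_trunc N (- s)) ^+ 2 <= expR (2 * q * `|s|) / q ^+ (2 * N).
    rewrite -real_normK ?num_real//.
    have -> : expR (2 * q * `|s|) / q ^+ (2 * N) = (expR (q * `|s|) / q ^+ N) ^+ 2.
      by rewrite expr_div_n -expRM_natl mulrA -exprM mulnC.
    apply: lerXn2r; rewrite ?nnegrE//.
      by apply: divr_ge0; rewrite ?expR_ge0//; apply/exprn_ge0/ltW.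
    by have := norm_expR_sub_trunc_le N (- s) q1; rewrite normrN.
  apply: (le_trans (ler_wpM2l (expR_ge0 _) tail)).
  rewrite mulrA mulrC; apply: ler_wpM2l; first by rewrite invr_ge0 exprn_ge0// ltW.
  rewrite -expRD; case: (ger0P s) => s0.
    rewrite (_ : - Q + _ = - (Q - 2 * q * s)); last by ring.
    by rewrite lerDr expR_ge0.
  rewrite (_ : - Q + _ = - (Q + 2 * q * s)); last by ring.
  by rewrite lerDl expR_ge0.
have mcut := measurable_cut_approx N.
have step : (\int[lebesgue_Rn R d]_z
     ((expR (- (2^-1) * qform G (colvec z)) - cut_approx N (colvec z) (colvec z)) ^+ 2)%:E <=
   \int[lebesgue_Rn R d]_z (((q ^+ (2 * N))^-1)%:E *
      (f (colvec z) + f (low *m colvec z - high *m colvec z)%R)))%E.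
  apply: ge0_le_integral => //.
  - by move=> z _; rewrite lee_fin sqr_ge0.
  - apply/measurable_EFinP/measurable_funX/measurable_funB => //.
    by apply/measurable_expR_comp/measurable_funM => //; exact: measurable_qform.
  - by apply: measurable_funeM; exact: emeasurable_funD.
apply: (le_trans step).
have fr0 v : (0 <= f v + f (low *m v - high *m v)%R)%E by rewrite adde_ge0.
rewrite ge0_integralZl_EFin//; last 2 first.
- exact: emeasurable_funD.
- by rewrite invr_ge0 exprn_ge0// ltW.
rewrite ge0_integralD// (integral_reflect k mf f0).
have -> : (\int[lebesgue_Rn R d]_z f (colvec z))%E = gauss_int T by [].
have := gauss_int_stretch Gsym lam0 sig0 Glam Gsig; rewrite -/T => hT.
have qi : (0 <= ((q ^+ (2 * N))^-1)%:E)%E by rewrite lee_fin invr_ge0 exprn_ge0// ltW.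
apply: (le_trans (lee_wpmul2l qi (leeD hT hT))).
rewrite -ge0_muleDl ?lee_fin ?exprn_ge0 ?sqrtr_ge0// -EFinD muleA -EFinM.
have e (X Y : R) : Y^-1 * (X + X) = 2 * X / Y by rewrite -mulr2n mulrC -[X *+ 2]mulr_natl.
by rewrite e.
Qed.

End CutApproximation.

(** * Step functions on a grid *)

Section Grid.
Variable R : realType.
Local Notation leb := (@lebesgue_measure R).

Definition halfgrid (m : nat) : nat := (m.+1 ^ 2)%N.
#[local] Arguments halfgrid : simpl never.

Definition gridsize (m : nat) : nat := (halfgrid m).*2.

(* The cells have length 1 / (m + 1) and cover [-(m + 1), m + 1[. *)
Definition cell (m : nat) (i : nat) : set (measurableTypeR R) :=
  [set x : R | i%:R <= x * m.+1%:R + (halfgrid m)%:R < i.+1%:R].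

(* The endpoint of the cell that is farthest from 0, so that functions of
   Gaussian decay are not increased by sampling. *)
Definition node (m : nat) (i : nat) : R :=
  ((if (halfgrid m <= i)%N then i.+1 else i)%:R - (halfgrid m)%:R) / m.+1%:R.

Lemma cell_itv m i : cell m i =
  `[(i%:R - (halfgrid m)%:R) / m.+1%:R, (i.+1%:R - (halfgrid m)%:R) / m.+1%:R[%classic.
Proof.
have m0 : 0 < m.+1%:R :> R by rewrite ltr0n.
by apply/seteqP; split=> x /=; rewrite in_itv/= ler_pdivrMr// ltr_pdivlMr// lerBlDr ltrBrDr.
Qed.

Lemma measurable_cell m i : measurable (cell m i).
Proof. by rewrite cell_itv; exact: measurable_itv. Qed.

Lemma lebesgue_measure_cell m i : leb (cell m i) = (m.+1%:R^-1)%:E.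
Proof.
have m0 : 0 < m.+1%:R :> R by rewrite ltr0n.
rewrite cell_itv lebesgue_measure_itv/= lte_fin ltr_pM2r ?invr_gt0// ltrD2r ltr_nat ltnSn.
rewrite -EFinB; congr (_%:E); rewrite -mulrBl -[i.+1%:R]natr1.
by rewrite (_ : _ - _ = 1) ?mul1r//; ring.
Qed.

Lemma cell_inj m i j (x : R) : cell m i x -> cell m j x -> i = j.
Proof. by move=> /= /truncn_def <- /truncn_def <-. Qed.

Lemma norm_node_ge m i (x : R) : cell m i x -> `|x| <= `|node m i|.
Proof.
have m0 : 0 < m.+1%:R :> R by rewrite ltr0n.
rewrite /cell/= /node => /andP[h1 h2]; set K := (halfgrid m)%:R in h1 h2 *.
have xE : x = (x * m.+1%:R) / m.+1%:R by rewrite mulfK// gt_eqF.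
rewrite [in leLHS]xE [leLHS]normrM [leRHS]normrM ler_wpM2r//.
case: ifPn => [Ki|]; last rewrite -ltnNge => Ki.
  have iK : K <= i%:R by rewrite ?/K ler_nat.
  have i1 : i%:R <= i.+1%:R :> R by rewrite ?/K ler_nat.
  have xm : 0 <= x * m.+1%:R by lra.
  by rewrite (ger0_norm xm) ger0_norm; lra.
have iK : i.+1%:R <= K by rewrite ?/K ler_nat.
have i1 : i%:R <= i.+1%:R :> R by rewrite ?/K ler_nat.
have xm : x * m.+1%:R <= 0 by lra.
by rewrite (ler0_norm xm) ler0_norm; lra.
Qed.

Lemma norm_node_sub_le m i (x : R) : cell m i x -> `|node m i - x| <= m.+1%:R^-1.
Proof.
have m0 : 0 < m.+1%:R :> R by rewrite ltr0n.
rewrite /cell/= /node => /andP[h1 h2]; set K := (halfgrid m)%:R in h1 h2 *.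
have -> b : (b - K) / m.+1%:R - x = (b - K - x * m.+1%:R) / m.+1%:R.
  by rewrite [in RHS]mulrBl mulfK// gt_eqF.
have mi : 0 < m.+1%:R^-1 :> R by rewrite invr_gt0.
rewrite normrM [`|_^-1|]gtr0_norm//; apply: ler_piMl; first exact: ltW.
have i1 : i.+1%:R = i%:R + 1 :> R by rewrite natr1.
by rewrite ler_norml; case: ifP => _; apply/andP; split; lra.
Qed.

Lemma cell_cover m (x : R) : `|x| < m.+1%:R ->
  exists i : 'I_(gridsize m), cell m i x.
Proof.
have m0 : 0 < m.+1%:R :> R by rewrite ltr0n.
move=> xm; pose y := x * m.+1%:R + (halfgrid m)%:R.
have [x1 x2] : - m.+1%:R < x /\ x < m.+1%:R.
  by move: xm; rewrite ltr_norml => /andP[].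
have K2 : (halfgrid m)%:R = m.+1%:R ^+ 2 :> R by rewrite /halfgrid natrX.
have y0 : 0 <= y by rewrite /y K2; nra.
have h := truncn_itv y0.
have it : (Num.truncn y < gridsize m)%N.
  rewrite -(ltr_nat R); apply: le_lt_trans (_ : y < _); first by case/andP: h.
  by rewrite /gridsize -muln2 natrM K2 /y K2; nra.
by exists (Ordinal it).
Qed.

Variable d : nat.

(** Defined on lists of any length, so that it applies to [take k s]; a missing entry counts as cell
    0. *)
Definition gridpt m (a : seq nat) : 'cV[R]_d := \col_j node m (nth 0%N a j).

Definition cellprod m (a : d.-tuple 'I_(gridsize m)) (z : Rn R d) : R :=
  \prod_(j < d) \1_(cell m (tnth a j)) (tnth z j).

Definition step m (c : d.-tuple 'I_(gridsize m) -> R) (z : Rn R d) : R :=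
  \sum_a c a * cellprod a z.

Lemma cellprod1 m (a : d.-tuple 'I_(gridsize m)) z :
  (forall j, cell m (tnth a j) (tnth z j)) -> cellprod a z = 1.
Proof.
by move=> h; rewrite /cellprod big1// => j _; rewrite indicE mem_set.
Qed.

Lemma cellprod0 m (a : d.-tuple 'I_(gridsize m)) z :
  ~ (forall j, cell m (tnth a j) (tnth z j)) -> cellprod a z = 0.
Proof.
move=> /existsNP[j h]; rewrite /cellprod (bigD1 j)//= indicE memNset ?mul0r//.
Qed.

Lemma step_case m (z : Rn R d) :
  (exists2 a : d.-tuple 'I_(gridsize m),
     forall j, cell m (tnth a j) (tnth z j) &
     forall c : d.-tuple 'I_(gridsize m) -> R, step c z = c a) \/
  ((forall c : d.-tuple 'I_(gridsize m) -> R, step c z = 0) /\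
   exists j, m.+1%:R <= `|tnth z j : R|).
Proof.
have [[a ha]|nex] := pselect (exists a : d.-tuple 'I_(gridsize m),
    forall j, cell m (tnth a j) (tnth z j)).
  left; exists a => // c; rewrite /step (bigD1 a)//= cellprod1// mulr1.
  rewrite big1 ?addr0// => b ba; rewrite cellprod0 ?mulr0// => hb.
  move/eqP: ba; apply; apply: eq_from_tnth => j; apply: ord_inj.
  exact: cell_inj (hb j) (ha j).
right; split.
  move=> c; rewrite /step big1// => a _; rewrite cellprod0 ?mulr0// => ha.
  by apply: nex; exists a.
apply: contrapT => /forallNP hz; apply: nex.
have hz' j : exists i : 'I_(gridsize m), cell m i (tnth z j).
  by apply: cell_cover; rewrite ltNge; apply/negP; exact: hz.
exists [tuple projT1 (cid (hz' j)) | j < d] => j; rewrite tnth_mktuple.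
by case: cid.
Qed.

Lemma step_comp m (c c' : d.-tuple 'I_(gridsize m) -> R) (f : R -> R -> R) z :
  f 0 0 = 0 -> f (step c z) (step c' z) = step (fun a => f (c a) (c' a)) z.
Proof.
by move=> f0; case: (step_case m z) => [[a _ h]|[h _]]; rewrite !h.
Qed.

Lemma measurable_cellprod m (a : d.-tuple 'I_(gridsize m)) :
  measurable_fun [set: Rn R d] (cellprod a).
Proof.
apply: measurable_prod => j _.
have mi : measurable_fun [set: measurableTypeR R]
    (\1_(cell m (tnth a j)) : measurableTypeR R -> R).
  by apply: measurable_indic; exact: measurable_cell.
exact: (measurableT_comp mi (measurable_tnth j)).
Qed.

Lemma measurable_step m (c : d.-tuple 'I_(gridsize m) -> R) :
  measurable_fun [set: Rn R d] (step c).
Proof.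
apply: measurable_sum => a; apply: measurable_funM; first exact: measurable_cst.
exact: measurable_cellprod.
Qed.

Lemma integral_cellprod m (a : d.-tuple 'I_(gridsize m)) :
  (\int[lebesgue_Rn R d]_z (cellprod a z)%:E = (m.+1%:R ^- d)%:E)%E.
Proof.
pose A := [set z : Rn R d | forall j, cell m (tnth a j) (tnth z j)].
have mA : measurable A.
  have -> : A = \bigcap_(j in [set: 'I_d])
      ((fun z : Rn R d => tnth z j) @^-1` cell m (tnth a j)).
    by apply/seteqP; split=> t /= h j; [move=> _; exact: h|exact: h].
  apply: fin_bigcap_measurable; first exact: finite_finset.
  move=> j _; rewrite -[X in measurable X]setTI.
  by apply: measurable_tnth => //; exact: measurable_cell.
transitivity (\int[lebesgue_Rn R d]_z (\1_A z)%:E)%E.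
  apply: eq_integral => z _; congr (_%:E); rewrite indicE.
  have [h|h] := pselect (A z); first by rewrite mem_set// cellprod1.
  by rewrite memNset// cellprod0.
rewrite integral_indic// setIT.
apply: (etrans (lebesgue_Rn_box (A := fun j => cell m (tnth a j)) _)) => [j|].
  exact: measurable_cell.
under eq_bigr do rewrite lebesgue_measure_cell.
by rewrite prodEFin prodr_const card_ord exprVn.
Qed.

Lemma integral_step m (c : d.-tuple 'I_(gridsize m) -> R) :
  (forall a, 0 <= c a) ->
  (\int[lebesgue_Rn R d]_z (step c z)%:E = (m.+1%:R ^- d * \sum_a c a)%:E)%E.
Proof.
move=> c0.
have cp0 a z : 0 <= cellprod a z :> R by apply: prodr_ge0 => j _; rewrite indicE.
have mcp (a : d.-tuple 'I_(gridsize m)) : measurable_fun [set: Rn R d] (cellprod a).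
  exact: measurable_cellprod.
under eq_integral do rewrite /step -sumEFin.
rewrite ge0_integral_sum//; last 2 first.
- by move=> a; apply/measurable_EFinP/measurable_funM.
- by move=> a z _; rewrite lee_fin mulr_ge0.
rewrite mulr_sumr -sumEFin; apply: eq_bigr => a _.
under eq_integral do rewrite EFinM.
rewrite ge0_integralZl_EFin//.
- by rewrite integral_cellprod -EFinM mulrC.
- by move=> z _; rewrite lee_fin.
- by apply/measurable_EFinP.
Qed.

End Grid.

(** The indicator of a product cell factors over the variables, and each core absorbs its own
    factor, so the extension to step functions keeps the ranks. *)
Lemma tt_val_step (R : realType) m n (r : nat -> nat)
    (g : forall j, 'I_(r j) -> 'I_(gridsize m) -> 'I_(r j.+1) -> R) (z : Rn R n) a :
  tt_val z (fun j a t b => \sum_i g j a i b * \1_(cell m i) t) a =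
  \sum_(s : n.-tuple 'I_(gridsize m)) tt_val s g a * cellprod s z.
Proof.
elim: n r g z a => [|n IHn] r g z a.
  rewrite tuple0 (big_pred1 [tuple]) /=; last by move=> t; apply/esym/eqP; exact: tuple0.
  by rewrite /cellprod big_ord0 mulr1.
case/tupleP: z => t z; rewrite sum_tupleS /=.
under eq_bigr => b _ do rewrite (IHn _ (fun j => g j.+1)) mulr_suml.
rewrite exchange_big/=; apply: eq_bigr => i _.
under eq_bigr => b _ do rewrite mulr_sumr.
rewrite exchange_big/=; apply: eq_bigr => s _.
rewrite mulr_suml; apply: eq_bigr => b _.
rewrite /cellprod big_ord_recl !tnth0; under [in RHS]eq_bigr do rewrite !tnthS.
by rewrite -!mulrA; congr (_ * _); rewrite mulrCA.
Qed.

(** * Convergence of sampled functions as the grid is refined *)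

Section SequentialContinuity.
Variables (R : realType) (d : nat).
Implicit Types (f g : 'cV[R]_d -> R).

(** Dominated convergence uses continuity along sequences only, and entrywise limits need no
    topology on column vectors. *)
Definition seq_cont f := forall (u : nat -> 'cV[R]_d) (v : 'cV[R]_d),
  (forall i, u m i 0 @[m --> \oo] --> v i 0) -> f (u m) @[m --> \oo] --> f v.

Lemma seq_cont_cst c : seq_cont (fun=> c).
Proof. by move=> u v uv; exact: cvg_cst. Qed.

Lemma seq_contD f g : seq_cont f -> seq_cont g -> seq_cont (fun v => f v + g v).
Proof. by move=> hf hg u v uv; apply: cvgD; [exact: hf|exact: hg]. Qed.

Lemma seq_contM f g : seq_cont f -> seq_cont g -> seq_cont (fun v => f v * g v).
Proof. by move=> hf hg u v uv; apply: cvgM; [exact: hf|exact: hg]. Qed.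

Lemma seq_contN f : seq_cont f -> seq_cont (fun v => - f v).
Proof. by move=> hf u v uv; apply: cvgN; exact: hf. Qed.

Lemma seq_contX f n : seq_cont f -> seq_cont (fun v => f v ^+ n).
Proof.
move=> hf; elim: n => [|n IHn] u v uv.
  by rewrite expr0; under eq_fun do rewrite expr0; exact: cvg_cst.
rewrite exprS; under eq_fun do rewrite exprS.
exact: (seq_contM hf IHn).
Qed.

Lemma seq_cont_sum (I : finType) (F : I -> 'cV[R]_d -> R) :
  (forall i, seq_cont (F i)) -> seq_cont (fun v => \sum_i F i v).
Proof.
move=> hF; elim: (index_enum I) => [|i s IHs].
  by move=> u v uv; rewrite big_nil; under eq_fun do rewrite big_nil; exact: cvg_cst.
move=> u v uv; rewrite big_cons; under eq_fun do rewrite big_cons.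
exact: (seq_contD (hF i) IHs).
Qed.

Lemma seq_cont_expR f : seq_cont f -> seq_cont (fun v => expR (f v)).
Proof.
by move=> hf u v uv; apply: (continuous_cvg _ (@continuous_expR R _)); exact: hf.
Qed.

Lemma seq_cont_qform (M : 'M[R]_d) : seq_cont (qform M).
Proof.
have -> : qform M = fun v => \sum_j \sum_i v i 0 * M i j * v j 0.
  by apply/funext => v; exact: qformE.
apply: seq_cont_sum => j; apply: seq_cont_sum => i.
by apply: seq_contM; [apply: seq_contM; [|exact: seq_cont_cst]|] => u v uv; exact: uv.
Qed.

Lemma seq_cont_qform_mulmx (P M : 'M[R]_d) : seq_cont (fun v => qform M (P *m v)).
Proof.
have -> : (fun v => qform M (P *m v)) = qform (P^T *m M *m P).
  by apply/funext => v; rewrite /qform trmx_mul !mulmxA.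
exact: seq_cont_qform.
Qed.

Lemma seq_cont_cut_approx k G N : seq_cont (fun v => cut_approx k G N v v).
Proof.
apply: seq_contM.
  apply: seq_cont_expR; apply: seq_contM; first exact: seq_cont_cst.
  by apply: seq_contD; exact: seq_cont_qform_mulmx.
apply: seq_cont_sum => n; apply: seq_contM; last exact: seq_cont_cst.
apply/seq_contX/seq_contN.
have -> : (fun v => cutform G (lowmx R d k *m v) (highmx R d k *m v)) = qform (cutmx k G).
  by apply/funext => v; rewrite cutmx_form.
exact: seq_cont_qform.
Qed.

Lemma seq_cont_gaussian (G : 'M[R]_d) :
  seq_cont (fun v => expR (- (2^-1) * qform G v)).
Proof.
by apply/seq_cont_expR/seq_contM; [exact: seq_cont_cst|exact: seq_cont_qform].
Qed.

End SequentialContinuity.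

Section Sampling.
Variables (R : realType) (d : nat).
Local Notation mu := (lebesgue_Rn R d).

Lemma measurable_expR_sqn (c : R) :
  measurable_fun [set: Rn R d] (fun z => expR (- (c * sqn (colvec z)))).
Proof.
apply/measurable_expR_comp/measurable_funN/measurable_funM; first exact: measurable_cst.
rewrite (_ : (fun z => _) = (fun z : Rn R d => qform 1%:M (colvec z))).
  exact: measurable_qform.
by apply/funext => z; rewrite /qform mulmx1.
Qed.

Lemma gauss_dominated_cvg (f_ : nat -> Rn R d -> R) (f : Rn R d -> R) (K c : R) :
  0 < c -> (forall m, measurable_fun [set: Rn R d] (f_ m)) ->
  measurable_fun [set: Rn R d] f ->
  (forall z, f_ m z @[m --> \oo] --> f z) ->
  (forall m z, `|f_ m z| <= K * expR (- (c * sqn (colvec z)))) ->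
  ((\int[mu]_z (f_ m z)%:E)%E @[m --> \oo] --> (\int[mu]_z (f z)%:E)%E).
Proof.
move=> c0 mf_ mf cf bf.
pose g (z : Rn R d) : \bar R := (K * expR (- (c * sqn (colvec z))))%:E.
have mg : measurable_fun [set: Rn R d] g.
  by apply/measurable_EFinP/measurable_funM; [exact: measurable_cst|exact: measurable_expR_sqn].
have ig : mu.-integrable [set: Rn R d] g.
  rewrite /g; under eq_fun do rewrite EFinM.
  apply: integrableZl => //; apply/integrableP; split.
    by apply/measurable_EFinP; exact: measurable_expR_sqn.
  under eq_integral do rewrite /= ger0_norm ?expR_ge0//.
  by rewrite integral_expR_sqn// ltry.
have [|||||_ _] := @dominated_convergence _ _ R mu setT measurableT
  (fun m z => (f_ m z)%:E) (fun z => (f z)%:E) g => //.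
- by move=> m; apply/measurable_EFinP.
- by apply/measurable_EFinP.
- by apply/aeW => z _; apply: cvg_EFin; [exact: nearW|exact: cf].
- by apply/aeW => z m _; rewrite /g lee_fin.
Qed.

Variables (g : 'cV[R]_d -> R) (C c : R).
Hypotheses (c0 : 0 < c) (gcont : seq_cont g).
Hypothesis gbnd : forall v, `|g v| <= C * expR (- (c * sqn v)).
Hypothesis gmeas : measurable_fun [set: Rn R d] (fun z => g (colvec z)).

Definition sample m (a : d.-tuple 'I_(gridsize m)) : R :=
  g (gridpt R d m (map val a)).

Lemma gridptE m (a : d.-tuple 'I_(gridsize m)) j :
  gridpt R d m (map val a) j 0 = node R m (tnth a j).
Proof.
rewrite mxE; congr node; rewrite (nth_map (tnth a j)) ?size_tuple//.
by rewrite -tnth_nth.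
Qed.

Lemma cvg_step_sample z : step (@sample m) z @[m --> \oo] --> g (colvec z).
Proof.
(* [u m] is the sampling point of the cell containing [z], or [z] itself as long as the grid does
   not reach it; in both cases [u m] tends to [z]. *)
have /choice[u hu] m : exists u : 'cV[R]_d,
    (forall i, `|u i 0 - tnth z i| <= m.+1%:R^-1) /\
    ((exists j, m.+1%:R <= `|tnth z j : R|) \/ step (@sample m) z = g u).
  case: (step_case m z) => [[a ha hs]|[_ hj]].
    exists (gridpt R d m (map val a)); split; last by right; rewrite hs.
    by move=> i; rewrite gridptE; apply: norm_node_sub_le; exact: ha.
  exists (colvec z); split; last by left.
  by move=> i; rewrite mxE subrr normr0 invr_ge0.
apply: (@cvg_trans _ (g (u m) @[m --> \oo])); last first.
  apply: gcont => i; rewrite mxE; apply/cvgrPdist_le => e e0.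
  have /cvgrPdist_le /(_ e e0) := @cvg_harmonic R; apply: filterS => m /=.
  rewrite sub0r normrN ger0_norm ?invr_ge0// => /(le_trans _); apply.
  rewrite distrC.
  by have [] := hu m.
apply: near_eq_cvg; near=> m.
have [_ []] := hu m => // -[j hj]; exfalso.
have : (Num.truncn (\sum_i `|tnth z i : R|) <= m)%N by near: m; exact: nbhs_infty_ge.
rewrite -(ler_nat R) => hm.
have h1 : `|tnth z j : R| <= \sum_i `|tnth z i : R|.
  by rewrite (bigD1 j)//= lerDl sumr_ge0.
have h2 := truncnS_gt (\sum_i `|tnth z i : R|).
have : (Num.truncn (\sum_i `|tnth z i : R|)).+1%:R <= m.+1%:R :> R.
  by rewrite ler_nat ltnS -(ler_nat R).
by move=> h3; move: hj; apply/negP; rewrite -ltNge; lra.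
Unshelve. all: by end_near. Qed.

(** The node is at least as far from 0 as [z] in every coordinate, so one majorant serves for all
    grids. *)
Lemma step_sample_le m z : `|step (@sample m) z| <= C * expR (- (c * sqn (colvec z))).
Proof.
have C0 : 0 <= C.
  by have := gbnd 0; move/(le_trans (normr_ge0 _)); rewrite pmulr_lge0// expR_gt0.
case: (step_case m z) => [[a ha hs]|[h0 _]]; last first.
  by rewrite h0 normr0 mulr_ge0// expR_ge0.
rewrite hs; apply: (le_trans (gbnd _)); apply: ler_wpM2l => //.
rewrite ler_expR lerN2; apply: ler_wpM2l; first exact: ltW.
rewrite !sqnE; apply: ler_sum => j _; rewrite gridptE mxE.
rewrite -[leLHS]real_normK ?num_real// -[leRHS]real_normK ?num_real//.
by apply: lerXn2r; rewrite ?nnegrE//; apply: norm_node_ge; exact: ha.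
Qed.

Lemma cvg_integral_step :
  (\int[mu]_z (step (@sample m) z)%:E)%E @[m --> \oo] -->
  (\int[mu]_z (g (colvec z))%:E)%E.
Proof.
apply: (gauss_dominated_cvg c0 _ gmeas cvg_step_sample step_sample_le) => m.
exact: measurable_step.
Qed.

Lemma cvg_integral_sqr_sub_step :
  (\int[mu]_z ((g (colvec z) - step (@sample m) z) ^+ 2)%:E)%E @[m --> \oo] --> 0%E.
Proof.
rewrite -(integral0 mu [set: Rn R d]).
apply: (@gauss_dominated_cvg _ (fun=> 0) ((2 * C) ^+ 2) c c0).
- by move=> m; apply: measurable_funX; apply: measurable_funB => //; exact: measurable_step.
- exact: measurable_cst.
- move=> z; rewrite [X in _ --> X](_ : 0 = (g (colvec z) - g (colvec z)) * (g (colvec z) - g (colvec z))); last by rewrite subrr mulr0.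
  under eq_fun do rewrite expr2.
  by apply: cvgM; apply: cvgB; [exact: cvg_cst|exact: cvg_step_sample|exact: cvg_cst|exact: cvg_step_sample].
move=> m z; rewrite normrX; set E := expR _.
have E0 : 0 < E by rewrite expR_gt0.
have E1 : E <= 1.
  by rewrite -expR0 ler_expR oppr_le0; apply: mulr_ge0; [exact: ltW|exact: sqn_ge0].
have h : `|g (colvec z) - step (@sample m) z| <= 2 * C * E.
  have := gbnd (colvec z); have := step_sample_le m z; rewrite -/E => h1 h2.
  by apply: (le_trans (ler_normB _ _)); lra.
apply: (@le_trans _ _ ((2 * C * E) ^+ 2)).
  by apply: lerXn2r; rewrite ?nnegrE// (le_trans _ h).
rewrite exprMn; apply: ler_wpM2l; first exact: sqr_ge0.
by rewrite expr2 ler_piMl// ltW.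
Qed.

End Sampling.

(** * Off-diagonal blocks *)

Section Selection.
Variables (R : comNzRingType) (m d : nat) (f : 'I_m -> 'I_d).

Definition selmx : 'M[R]_(m, d) := \matrix_(i, a) (a == f i)%:R.

Lemma selmx_mul n (M : 'M[R]_(d, n)) i j : (selmx *m M) i j = M (f i) j.
Proof.
rewrite mxE (bigD1 (f i))//= mxE eqxx mul1r big1 ?addr0// => a ai.
by rewrite mxE (negbTE ai) mul0r.
Qed.

Lemma selmx_tr : injective f -> selmx *m selmx^T = 1%:M.
Proof.
by move=> f_inj; apply/matrixP => i j; rewrite selmx_mul !mxE (inj_eq f_inj).
Qed.

Lemma tr_selmx (P : pred 'I_d) : injective f -> (forall i, P (f i)) ->
  (forall a, P a -> exists i, a = f i) ->
  selmx^T *m selmx = diag_mx (\row_a (P a)%:R).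
Proof.
move=> f_inj Pf fP; apply/matrixP => a b; rewrite !mxE.
have [Pa|nPa] := boolP (P a); last first.
  rewrite mul0rn big1// => i _; rewrite !mxE; case: eqP => [ai|]; last by rewrite mul0r.
  by move: nPa; rewrite ai Pf.
have [i ->] := fP _ Pa; rewrite (bigD1 i)//= !mxE eqxx mul1r eq_sym.
rewrite big1 ?addr0 // => j ij.
by rewrite !mxE (inj_eq f_inj) eq_sym (negbTE ij) mul0r.
Qed.

End Selection.

Section SubdiagonalBlock.
Variables (R : realType) (d : nat) (G : 'M[R]_d) (k : 'I_d).

Let hi (i : 'I_(d - k)) : 'I_d :=
  cast_ord (subnKC (ltnW (ltn_ord k))) (rshift k i).
Let lo (j : 'I_k) : 'I_d := widen_ord (ltnW (ltn_ord k)) j.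
Let F := selmx R hi.
Let E := selmx R lo.

Let hi_inj : injective hi.
Proof. by move=> i j /cast_ord_inj /rshift_inj. Qed.

Let lo_inj : injective lo.
Proof. by move=> i j /(congr1 val) /= /ord_inj. Qed.

Let trE_E : E^T *m E = lowmx R d k.
Proof.
apply: (tr_selmx _ (P := fun a : 'I_d => (a < k)%N) lo_inj) => [i|a ak].
  exact: (ltn_ord i).
by exists (Ordinal ak); apply: ord_inj.
Qed.

Let trF_F : F^T *m F = highmx R d k.
Proof.
rewrite /F (tr_selmx _ (P := fun a : 'I_d => (k <= a)%N) hi_inj).
- by apply/matrixP => a b; rewrite !mxE leqNgt; case: (a < k)%N;
    case: (a == b); rewrite ?subrr ?subr0.
- by move=> i; rewrite /= leq_addr.
move=> a ka; have h : (a - k < d - k)%N by rewrite ltn_sub2r// (leq_ltn_trans ka).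
by exists (Ordinal h); apply: ord_inj; rewrite /= subnKC.
Qed.

Let blockE : subdiag_block G k = F *m G *m E^T.
Proof.
apply/matrixP => i j; rewrite -mulmxA selmx_mul.
have -> : (G *m E^T) (hi i) j = (E *m G^T) j (hi i).
  by rewrite -[in RHS](trmxK (E *m G^T)) trmx_mul trmxK [RHS]mxE.
by rewrite selmx_mul !mxE.
Qed.

(** [cutmx] is the subdiagonal block padded with zeros, which carries rank and norm bounds over to
    it. *)
Let cutmxE : cutmx k G = F^T *m subdiag_block G k *m E.
Proof. by rewrite blockE !mulmxA trF_F -[_ *m E^T *m E]mulmxA trE_E. Qed.

Lemma rank_cutmx_le : (\rank (cutmx k G) <= \rank (subdiag_block G k))%N.
Proof. by rewrite cutmxE (leq_trans (mxrankM_maxl _ _))// mxrankM_maxr. Qed.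

Lemma sqn_cutmx_le (s : seq R) (sigma : R) :
  singular_values (subdiag_block G k) s -> nth 0 s 0 <= sigma ->
  forall v, sqn (cutmx k G *m v) <= sigma ^+ 2 * sqn (lowmx R d k *m v).
Proof.
move=> hs ssig v.
have s0 : 0 <= nth 0 s 0.
  by case: hs => _ + _; case: (s) => //= x s' /andP[].
have sqnE v' : sqn (E *m v') = sqn (lowmx R d k *m v').
  rewrite /sqn !trmx_mul tr_lowmx -!mulmxA (mulmxA E^T) trE_E.
  by rewrite (mulmxA (lowmx _ _ _) (lowmx _ _ _)) lowmx_idem.
have -> : sqn (cutmx k G *m v) = sqn (subdiag_block G k *m (E *m v)).
  rewrite cutmxE -!mulmxA; set w := subdiag_block G k *m _.
  rewrite /sqn trmx_mul trmxK -mulmxA (mulmxA F F^T).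
  by rewrite (selmx_tr _ hi_inj) mul1mx.
rewrite -sqnE; apply: (le_trans (singular_values_norm_le hs _)).
apply: ler_wpM2r; first exact: sqn_ge0.
by apply: lerXn2r; rewrite ?nnegrE// (le_trans s0).
Qed.

End SubdiagonalBlock.

(** * Choice of the Taylor degree *)

Section RankEstimates.
Variable R : realType.
Implicit Types x y : R.

Lemma ln2_gt0 : 0 < ln (2 : R). Proof. by rewrite ln_gt0// ltr1n. Qed.

Lemma ln2_le1 : ln (2 : R) <= 1.
Proof.
by have := @le_ln1Dx R 1 ltac:(lra); rewrite (_ : 1 + 1 = 2 :> R)//; lra.
Qed.

Lemma ln_le_sub1 x : 0 < x -> ln x <= x - 1.
Proof.
move=> x0; have -> : x = 1 + (x - 1) by ring.
by rewrite [leRHS](_ : _ = x - 1); [apply: le_ln1Dx; lra|ring].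
Qed.

Lemma ln_sqrt8 : ln (Num.sqrt (8 : R)) = 3 / 2 * ln 2.
Proof.
have h : ln (Num.sqrt (8 : R)) *+ 2 = ln 2 *+ 3.
  rewrite -!lnXn// ?sqrtr_gt0// sqr_sqrtr//; congr ln.
  by rewrite -natrX.
by move: h; rewrite -[LHS]mulr_natr -[RHS]mulr_natr => h; lra.
Qed.

Lemma rank_baseE (d l : nat) (sigma lmin eps : R) :
  (0 < d)%N -> (0 < l)%N -> 0 < eps ->
  rank_base d l sigma lmin eps =
  (1 + 7 * (sigma / lmin)) * (3 / 2 * ln 2 + ln d%:R - ln eps) +
  (3 / 2 + ln l%:R - ln 2).
Proof.
move=> d0 l0 e0; have dR : 0 < d%:R :> R by rewrite ltr0n.
have lR : 0 < l%:R :> R by rewrite ltr0n.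
have e1 : ln (Num.sqrt 8 * d%:R / eps) = 3 / 2 * ln 2 + ln d%:R - ln eps.
  by rewrite ln_div ?lnM ?posrE ?mulr_gt0 ?sqrtr_gt0// ln_sqrt8.
have e2 : ln (expR (3 / 2) * (l%:R / 2)) = 3 / 2 + ln l%:R - ln 2 :> R.
  by rewrite lnM ?posrE ?expR_gt0 ?divr_gt0// expRK ln_div ?posrE// addrA.
by rewrite /rank_base e1 e2.
Qed.

(* sqrt 8 e^(3/2) / 2 <= 7 amounts to 2 e^3 <= 49, and e^(1/10) <= 10/9. *)
Lemma expR3_le : 2 * expR (3 : R) <= 49.
Proof.
have h : expR (10^-1 : R) <= 10 / 9.
  have := expR_ge1Dx (- (10^-1 : R)); rewrite expRN => h.
  have e0 := expR_gt0 (10^-1 : R).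
  have e1 : expR (10^-1 : R) * (expR (10^-1 : R))^-1 = 1 by rewrite divff// gt_eqF.
  by move: (expR _) (expR _)^-1 h e0 e1 => a b; nra.
have -> : (3 : R) = 30%:R * 10^-1 by rewrite -[30%:R]/(30 : R); field.
rewrite expRM_natl; move: h (expR_gt0 (10^-1 : R)); move: (expR _) => a h a0.
have sq n (b c : R) : a ^+ n <= b -> b * b <= c -> a ^+ (n + n) <= c.
  move=> hb hc; have an : 0 <= a ^+ n by rewrite exprn_ge0// ltW.
  by rewrite exprD (le_trans _ hc)// ler_pM.
have a3 : a ^+ 3 <= 1372 / 1000.
  have : a ^+ 3 <= (10 / 9) ^+ 3 by apply: lerXn2r; rewrite ?nnegrE//; lra.
  by move/le_trans; apply; rewrite !exprS expr0; lra.
have a6 : a ^+ 6 <= 1883 / 1000 by apply: (sq 3%N _ _ a3); lra.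
have a12 : a ^+ 12 <= 3546 / 1000 by apply: (sq 6%N _ _ a6); lra.
have a24 : a ^+ 24 <= 1258 / 100 by apply: (sq 12%N _ _ a12); lra.
have a60 : 0 <= a ^+ 6 by rewrite exprn_ge0// ltW.
have a240 : 0 <= a ^+ 24 by rewrite exprn_ge0// ltW.
have -> : a ^+ 30 = a ^+ 24 * a ^+ 6 by rewrite -exprD.
have h30 := ler_pM a240 a60 a24 a6.
by move: (_ * a ^+ 6) h30 => t; lra.
Qed.

(** Without the terms in sigma / lmin the inequality is [3 + ln 2 <= 2 * ln 7], which is [expR3_le];
    the coefficient of sigma / lmin in the difference is nonnegative. *)
Lemma rank_base_le (d l : nat) (sigma lmin eps : R) :
  (0 < d)%N -> (0 < l)%N -> 0 < eps -> 0 <= sigma / lmin ->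
  rank_base d l sigma lmin eps <=
  (1 + 7 * (sigma / lmin)) * ln (7 * l%:R * (d%:R / eps)).
Proof.
move=> d0 l0 e0 k0; rewrite rank_baseE//.
have dR : 0 < d%:R :> R by rewrite ltr0n.
have lR : 0 < l%:R :> R by rewrite ltr0n.
have l1 : 0 <= ln l%:R :> R by rewrite ln_ge0// ler1n.
have -> : ln (7 * l%:R * (d%:R / eps)) = ln 7 + ln l%:R + (ln d%:R - ln eps).
  have de : 0 < d%:R / eps by rewrite divr_gt0.
  have l7 : 0 < 7 * l%:R :> R by rewrite mulr_gt0.
  have p7 : 0 < 7 :> R by [].
  by rewrite (lnM l7 de) (lnM p7 lR) ln_div.
have h7 : ln 2 + 3 <= ln 7 + ln 7 :> R.
  rewrite -lnM ?posrE// -[3]expRK -lnM ?posrE ?expR_gt0// ler_ln ?posrE ?mulr_gt0 ?expR_gt0//.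
  by rewrite (_ : 7 * 7 = 49) ?expR3_le// -natrM.
have h2 := ln2_le1; move: (sigma / lmin) k0 => k k0.
have hB : 0 <= ln 7 + ln l%:R - 3 / 2 * ln 2 :> R by lra.
by have := mulr_ge0 k0 hB; lra.
Qed.

Lemma taylor_degree (d l rho : nat) (sigma lmin eps : R) :
  (2 <= d)%N -> (0 < rho)%N -> (rho <= l)%N -> (rho <= d)%N ->
  0 < lmin -> 0 < sigma -> 0 < eps -> eps < 1 ->
  1 <= rank_base d l sigma lmin eps ->
  exists N : nat,
    'C(N + rho, rho)%:R <= rank_base d l sigma lmin eps ^+ l /\
    4 * d%:R * Num.sqrt 2 ^+ rho <=
      eps ^+ 2 * (1 + lmin / sigma / 2) ^+ (2 * N.+1).
Proof.
move=> d2 r0 rl rd lm0 s0 e0 e1 hb.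
have d0 : (0 < d)%N by exact: leq_trans d2.
have l0 : (0 < l)%N by exact: leq_trans rl.
have dR : 0 < d%:R :> R by rewrite ltr0n.
have rR : 0 < rho%:R :> R by rewrite ltr0n.
have r1 : 1 <= rho%:R :> R by rewrite ler1n.
set kap := sigma / lmin; have k0 : 0 < kap by rewrite divr_gt0.
set q := 1 + lmin / sigma / 2.
have qE : q = 1 + (2 * kap)^-1 by rewrite /q /kap invfM invf_div mulrC.
have q1 : 1 < q by rewrite qE ltrDl invr_gt0 mulr_gt0.
have q0 : 0 < q by lra.
(* Since 1 - 1 / q = 1 / a, the inequality ln x <= x - 1 at x = 1 / q gives ln q >= 1 / a. *)
pose a := 1 + 2 * kap.
have a0 : 0 < a by rewrite /a; lra.
have lnq : 1 <= a * ln q.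
  have qi : 0 < q^-1 by rewrite invr_gt0.
  have h := ln_le_sub1 qi; rewrite lnV ?posrE// in h.
  have aq : a * (1 - q^-1) = 1.
    by rewrite /a qE; field; apply/andP; split; apply: lt0r_neq0; lra.
  by rewrite -aq ler_wpM2l ?(ltW a0)//; lra.
pose L := 3 / 2 * ln 2 + ln d%:R - ln eps.
have lne : ln eps <= 0 by rewrite ln_le0// ltW.
have ln2 := ln2_gt0; have ln21 := ln2_le1.
have lnd : ln 2 <= ln d%:R :> R by rewrite ler_ln ?posrE// ler_nat.
have lnr0 : 0 <= ln rho%:R :> R by rewrite ln_ge0.
have lnrd : ln rho%:R <= ln d%:R :> R by rewrite ler_ln ?posrE// ler_nat.
have lnrl : ln rho%:R <= ln l%:R :> R by rewrite ler_ln ?posrE ?ltr0n// ler_nat.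
have lnr : ln rho%:R <= rho%:R - 1 :> R by exact: ln_le_sub1.
(* In logarithms the error requirement is a lower bound for (N + 1) ln q. [Y] exceeds that bound by
   ln (d / 2) / 2, which is nonnegative as [2 <= d], and N = floor (a Y) gives N + 1 > Y / ln q up
   to equality. *)
pose Y := L - ln 2 + rho%:R / 4 * ln 2.
have Y0 : 0 <= Y by rewrite /Y /L; nra.
pose x := a * Y; have x0 : 0 <= x by rewrite mulr_ge0// ltW.
exists (Num.truncn x); have /andP[Nx xN] := truncn_itv x0.
set N := Num.truncn x in Nx xN *; split.
  apply: le_trans (_ : rank_base d l sigma lmin eps ^+ rho <= _); last exact: ler_weXn2l.
  apply: (le_trans (binomial_le_exp _ _ r0)).
  (* [S] is at most 1, and rho S = 1 + ln rho reduces the linear term [rho / 4 * ln 2] of [Y] to a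
     logarithmic one. Its share multiplied by kap is then absorbed by [7 * L], using ln rho <= L. *)
  pose S : R := (1 + ln rho%:R) / rho%:R.
  have S0 : 0 <= S by rewrite divr_ge0// ?ltW//; lra.
  have S1 : S <= 1 by rewrite ler_pdivrMr//; lra.
  have rS : rho%:R * S = 1 + ln rho%:R by rewrite mulrC divfK// gt_eqF.
  rewrite -[N%:R * _ / _]mulrA -/S; apply: lerXn2r; rewrite ?nnegrE.
  - by rewrite addr_ge0// mulr_ge0.
  - by rewrite (le_trans _ hb).
  rewrite rank_baseE// -/kap -/L.
  have h1 : N%:R * S <= x * S by rewrite ler_wpM2r.
  have h2 : x * S <= a * (L - ln 2 + (1 + ln rho%:R) / 4 * ln 2).
    rewrite /x -mulrA ler_pM2l// /Y -rS.
    have : (L - ln 2) * S <= L - ln 2 by rewrite ler_piMr// /L; lra.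
    by lra.
  have h3 : ln 2 * ln rho%:R <= ln rho%:R :> R by rewrite ler_piMl.
  have h4 : ln rho%:R <= L by rewrite /L; lra.
  have h5 : kap * (2 * (L - ln 2 + (1 + ln rho%:R) / 4 * ln 2)) <= kap * (7 * L).
    by rewrite ler_pM2l//; lra.
  by rewrite /a in h2; lra.
rewrite -ler_ln ?posrE; last 2 first.
- by rewrite mulr_gt0 ?exprn_gt0 ?sqrtr_gt0// mulr_gt0.
- by rewrite mulr_gt0 ?exprn_gt0.
have s2 : ln (Num.sqrt (2 : R)) = ln 2 / 2.
  have h : ln (Num.sqrt (2 : R)) + ln (Num.sqrt 2) = ln 2.
    by rewrite -lnM ?posrE// -expr2 sqr_sqrtr.
  by lra.
have four : ln (4 : R) = ln 2 + ln 2.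
  by rewrite -lnM ?posrE//; congr ln; rewrite -natrM.
have p4 : 0 < 4 :> R by [].
have e2 : 0 < eps ^+ 2 by rewrite exprn_gt0.
have qn : 0 < q ^+ (2 * N.+1) by rewrite exprn_gt0.
have sr : 0 < Num.sqrt 2 ^+ rho :> R by rewrite exprn_gt0.
rewrite (lnM (mulr_gt0 p4 dR) sr) (lnM p4 dR) (lnM e2 qn) !lnXn// s2 four.
rewrite -[ln eps *+ 2]mulr_natl -[ln q *+ _]mulr_natl -[_ *+ rho]mulr_natl natrM.
have h : Y <= N.+1%:R * ln q.
  have h1 : Y <= Y * (a * ln q) by rewrite ler_peMr.
  apply: (le_trans h1); rewrite mulrA [Y * a]mulrC -/x ler_wpM2r ?ltW//.
  by rewrite ln_gt0.
rewrite -(mulrA 2%:R); move: h lnd; rewrite /Y /L.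
move: (N.+1%:R * ln q) (ln eps) (ln d%:R) (ln 2) (rho%:R : R) => t e D w r.
by clear; lra.
Qed.

End RankEstimates.

(** * Assembling the cuts *)

Lemma ereal_cvg_lt (R : realType) (u : nat -> \bar R) (l b : \bar R) :
  u m @[m --> \oo] --> l -> (l < b)%E -> exists m, (u m < b)%E.
Proof.
move=> ul lb.
have ob : open_nbhs l [set y : \bar R | (y < b)%E].
  by split => //; exact: open_ereal_lt_ereal.
have [m _ hm] := ul _ (open_nbhs_nbhs ob).
by exists m; exact: (hm m (leqnn m)).
Qed.

Section Discretization.
Variables (R : realType) (n : nat).
Local Notation d := n.+1.
Local Notation mu := (lebesgue_Rn R d).
Variables (f : 'cV[R]_d -> R) (cut : nat -> 'cV[R]_d -> R) (r : nat -> nat).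
Variables (c eta : R) (delta : nat -> R).
Hypotheses (c0 : 0 < c) (fcont : seq_cont f) (ccont : forall k, seq_cont (cut k)).
Hypothesis fbnd : forall v, `|f v| <= expR (- (c * sqn v)).
Hypothesis cbnd : forall k v, `|cut k v| <= expR (- (c * sqn v)).
Hypothesis fmeas : measurable_fun [set: Rn R d] (fun z => f (colvec z)).
Hypothesis cmeas : forall k, measurable_fun [set: Rn R d] (fun z => cut k (colvec z)).
Hypothesis r0 : r 0%N = 1%N.
Hypothesis rd : r d = 1%N.
Hypothesis rpos : forall k, (0 < k < d)%N -> (1 <= r k)%N.
Hypothesis cutrank : forall k m, (0 < k < d)%N -> exists phi psi, forall s, size s = d ->
  cut k (gridpt R d m s) = \sum_(b < r k) phi (take k s) b * psi b (drop k s).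
Hypothesis cuterr : forall k, (0 < k < d)%N ->
  (\int[mu]_z ((f (colvec z) - cut k (colvec z)) ^+ 2)%:E <= (delta k)%:E)%E.
Hypothesis etaP : \sum_(1 <= k < d) delta k < eta.

Let err k v := (f v - cut k v) ^+ 2.

Let err_cont k : seq_cont (err k).
Proof. by apply: seq_contX; apply: seq_contD => //; exact: seq_contN. Qed.

Let err_bnd k v : `|err k v| <= 4 * expR (- (c * sqn v)).
Proof.
rewrite /err normrX; have h1 := fbnd v; have h2 := cbnd k v.
set E := expR _ in h1 h2 *.
have E0 : 0 < E by exact: expR_gt0.
have E1 : E <= 1.
  by rewrite -expR0 ler_expR oppr_le0; apply: mulr_ge0; [exact: ltW|exact: sqn_ge0].
have h : `|f v - cut k v| <= 2 * E by apply: (le_trans (ler_normB _ _)); lra.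
have : `|f v - cut k v| ^+ 2 <= (2 * E) ^+ 2.
  by apply: lerXn2r; rewrite ?nnegrE// (le_trans _ h).
move/le_trans; apply; rewrite exprMn -natrX; apply: ler_wpM2l => //.
by rewrite expr2 ler_piMl// ltW.
Qed.

Let err_meas k : measurable_fun [set: Rn R d] (fun z => err k (colvec z)).
Proof. by apply: measurable_funX; apply: measurable_funB => //; exact: cmeas. Qed.

(** Sampling error plus sampled cut errors. The first tends to 0 and the others to the true cut
    errors, whose sum is strictly below [eta]; some grid therefore stays below [eta]. *)
Let grid_error m : \bar R := (\int[mu]_z ((f (colvec z) - step (@sample R d f m) z) ^+ 2)%:E +
  \sum_(1 <= k < d) \int[mu]_z (step (@sample R d (err k) m) z)%:E)%E.

Let fine_grid : exists m, (grid_error m < eta%:E)%E.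
Proof.
pose l := (0 + \sum_(1 <= k < d) \int[mu]_z (err k (colvec z))%:E)%E.
have le_l : (l < eta%:E)%E.
  rewrite /l add0e; apply: (@le_lt_trans _ _ (\sum_(1 <= k < d) (delta k)%:E)%E).
    rewrite big_nat_cond [leRHS]big_nat_cond.
    by apply: lee_sum => k /andP[kd _]; exact: cuterr.
  by rewrite sumEFin lte_fin.
apply: ereal_cvg_lt le_l; apply: cvgeD.
- by [].
- apply: (cvg_integral_sqr_sub_step (C := 1) c0 fcont _ fmeas) => v.
  by rewrite mul1r; exact: fbnd.
rewrite big_seq_cond; under eq_fun do rewrite big_seq_cond.
apply: cvg_nnesum => k.
  by move=> _; apply: nearW => m; apply: integral_ge0 => z _; rewrite lee_fin;
    case: (step_case m z) => [[a _ ->]|[-> _]]//; exact: sqr_ge0.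
move=> _; exact: (cvg_integral_step c0 (@err_cont k) (@err_bnd k) (@err_meas k)).
Qed.

Lemma ftt_discretization : exists fhat : Rn R d -> R,
  [/\ measurable_fun [set: Rn R d] fhat,
      (\int[mu]_z ((fhat z) ^+ 2)%:E < +oo)%E,
      has_ftt fhat r &
      (\int[mu]_z ((f (colvec z) - fhat z) ^+ 2)%:E <= (2 * eta)%:E)%E].
Proof.
have [m hm] := fine_grid.
pose pt (s : seq 'I_(gridsize m)) := gridpt R d m (map val s).
pose cc (_ : 'I_(r 0%N)) s := f (pt s).
pose cutc k (_ : 'I_(r 0%N)) s := cut k (pt s).
have [|g hg] := @tt_rounding R 'I_(gridsize m) n r cc cutc rd.
  move=> k kd; have [phi [psi h]] := cutrank m kd.
  exists (fun _ s => phi (map val s)), (fun b s => psi b (map val s)) => a s ss.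
  by rewrite /cutc /pt h ?size_map// map_take map_drop.
pose a0 : 'I_(r 0%N) := cast_ord (esym r0) ord0.
pose chat (s : d.-tuple 'I_(gridsize m)) := tt_val s g a0.
have sum0 (F : 'I_(r 0%N) -> R) : \sum_a F a = F a0.
  apply: big_pred1 => a; apply/esym/eqP/ord_inj => /=; apply/eqP.
  by rewrite -leqn0 -ltnS; have := ltn_ord a; rewrite [X in (_ < X)%N]r0.
have mstep (h : d.-tuple _ -> R) : measurable_fun [set: Rn R d] (@step R d m h).
  exact: measurable_step.
exists (step chat); split => //.
- have -> : (fun z => ((step chat z) ^+ 2)%:E) =
      (fun z => (step (fun s => chat s ^+ 2) z)%:E).
    apply/funext => z; congr (_%:E).
    by rewrite (step_comp chat chat (f := fun x _ => x ^+ 2))// expr0n.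
  by rewrite integral_step ?ltry// => a; exact: sqr_ge0.
- split=> //.
  exists (fun j a t b => \sum_i g j a i b * \1_(cell m i) t); split.
    move=> j a b _; apply: measurable_sum => i.
    apply: measurable_funM; first exact: measurable_cst.
    by apply: measurable_indic; exact: measurable_cell.
  apply/aeW => z _; by rewrite (ftt_eval_tt_val _ _ r0 rd) tt_val_step.
pose s1 := @sample R d f m.
have mE (h : Rn R d -> R) : measurable_fun [set: Rn R d] h ->
    measurable_fun [set: Rn R d] (fun z => (h z ^+ 2)%:E).
  by move=> mh; apply/measurable_EFinP/measurable_funX.
have m1 : measurable_fun [set: Rn R d] (fun z => ((f (colvec z) - step s1 z) ^+ 2)%:E).
  by apply: mE; exact: measurable_funB.
have m2 : measurable_fun [set: Rn R d] (fun z => ((step s1 z - step chat z) ^+ 2)%:E).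
  by apply: mE; exact: measurable_funB.
have sq0 (x : R) : (0 <= (x ^+ 2)%:E)%E by rewrite lee_fin sqr_ge0.
(* The step function of the samples is inserted between [f] and the rounded tensor train; this is
   the origin of the 2 in [2 * eta]. *)
have split2 : (\int[mu]_z ((f (colvec z) - step chat z) ^+ 2)%:E <=
    2%:E * (\int[mu]_z ((f (colvec z) - step s1 z) ^+ 2)%:E +
            \int[mu]_z ((step s1 z - step chat z) ^+ 2)%:E))%E.
  rewrite -ge0_integralD// -ge0_integralZl_EFin//; last 2 first.
  - by move=> z _; exact: adde_ge0.
  - exact: emeasurable_funD.
  apply: ge0_le_integral => //.
  - by apply: mE; exact: measurable_funB.
  - by apply: measurable_funeM; exact: emeasurable_funD.
  move=> z _; rewrite -EFinD -EFinM lee_fin.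
  have := sqr_ge0 ((f (colvec z) - step s1 z) - (step s1 z - step chat z)).
  by move: (f (colvec z)) (step s1 z) (step chat z) => x y w; nra.
apply: (le_trans split2); rewrite EFinM; apply: lee_wpmul2l => //.
apply: le_trans (ltW hm); apply: leeD => //.
have -> : (fun z => ((step s1 z - step chat z) ^+ 2)%:E) =
    (fun z => (step (fun s => (s1 s - chat s) ^+ 2) z)%:E).
  apply/funext => z; congr (_%:E).
  by rewrite (step_comp s1 chat (f := fun x y => (x - y) ^+ 2))// subrr expr0n.
rewrite integral_step; last by move=> a; exact: sqr_ge0.
under [leRHS]eq_bigr => k _.
  rewrite integral_step; last by move=> ?; exact: sqr_ge0.
  over.
(* All cells have the same volume, so it factors out and the rounding inequality between finite sums
   remains. *)
rewrite sumEFin lee_fin -mulr_sumr; apply: ler_wpM2l.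
  by rewrite invr_ge0 exprn_ge0.
move: hg; rewrite sum0 => /le_trans; apply; apply: ler_sum_nat => k _.
by rewrite sum0.
Qed.

End Discretization.

(** * From squared integrals to L^2 norms *)

Section NormTwo.
Variables (R : realType) (d : nat).
Local Notation mu := (lebesgue_Rn R d).

Lemma Lnorm2E (h : Rn R d -> R) :
  ('N[mu]_2%:E[EFin \o h] = (\int[mu]_z ((h z) ^+ 2)%:E) `^ (2^-1))%E.
Proof.
rewrite unlock /Lnorm; congr (_ `^ _)%E; apply: eq_integral => z _ /=.
by rewrite powR_mulrn// real_normK ?num_real.
Qed.

Lemma Lfun2_of_sqr (h : Rn R d -> R) : measurable_fun [set: Rn R d] h ->
  (\int[mu]_z ((h z) ^+ 2)%:E < +oo)%E -> h \in Lfun mu 2%:E.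
Proof.
move=> mh fh; apply/andP; split; rewrite inE//=.
rewrite /finite_norm Lnorm2E; exact: poweR_lty.
Qed.

Lemma le_Lnorm2 (h h' : Rn R d -> R) (e : R) : 0 <= e ->
  (\int[mu]_z ((h z) ^+ 2)%:E <= (e ^+ 2)%:E * \int[mu]_z ((h' z) ^+ 2)%:E)%E ->
  ('N[mu]_2%:E[EFin \o h] <= e%:E * 'N[mu]_2%:E[EFin \o h'])%E.
Proof.
move=> e0 hh; rewrite !Lnorm2E.
have i0 (u : Rn R d -> R) : (0 <= \int[mu]_z ((u z) ^+ 2)%:E)%E.
  by apply: integral_ge0 => z _; rewrite lee_fin sqr_ge0.
have -> : e%:E = (((e ^+ 2)%:E) `^ (2^-1))%E.
  by rewrite poweR_EFin -powR_mulrn// -powRrM mulfV// powRr1.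
rewrite -poweRM ?lee_fin ?sqr_ge0//; apply: gt0_ler_poweR => //.
- by rewrite in_itv/= i0 leey.
- by rewrite in_itv/= leey andbT mule_ge0// lee_fin sqr_ge0.
Qed.

End NormTwo.

Lemma cut_approx_gridpt (R : realType) d k (G : 'M[R]_d) N m (s : seq nat) :
  size s = d -> (k <= d)%N ->
  cut_approx k G N (gridpt R d m s) (gridpt R d m s) =
  cut_approx k G N (gridpt R d m (take k s)) (gridpt R d m (nseq k 0%N ++ drop k s)).
Proof.
move=> ss kd.
have lowE : lowmx R d k *m gridpt R d m s = lowmx R d k *m gridpt R d m (take k s).
  apply/matrixP => i j; rewrite ord1 !lowmxE !mxE.
  by case: ifP => // ik; rewrite nth_take.
have highE : highmx R d k *m gridpt R d m s =
    highmx R d k *m gridpt R d m (nseq k 0%N ++ drop k s).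
  apply/matrixP => i j; rewrite ord1 !highmxE !mxE.
  case: ltnP => // ki.
  by rewrite nth_cat size_nseq ltnNge ki/= nth_drop subnKC.
by rewrite /cut_approx lowE highE.
Qed.

Section PositiveDefinite.
Variables (R : realType) (d : nat) (G : 'M[R]_d) (lmin : R).
Hypotheses (Gsym : G^T = G) (Gpos : posdefmx G) (hlmin : smallest_eigenvalue G lmin).

Lemma smallest_eigenvalue_gt0 : 0 < lmin.
Proof.
have [/eigenvalueP[u uG u0] _] := hlmin.
have ut0 : u^T != 0 by rewrite -trmx0 (inj_eq trmx_inj).
have := Gpos ut0; rewrite trmxK uG -scalemxAl mxE.
have -> : (u *m u^T) 0 0 = sqn u^T by rewrite /sqn trmxK.
by rewrite pmulr_lgt0// lt_def sqn_ge0 sqn_eq0 ut0.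
Qed.

Lemma smallest_eigenvalue_form v : lmin * sqn v <= qform G v.
Proof. by apply: sym_form_ge => // a; case: hlmin => _; apply. Qed.

Lemma gauss_int_fin : exists2 Z : R, 0 < Z & gauss_int G = Z%:E.
Proof.
have l0 := smallest_eigenvalue_gt0.
have [c c0 hc] := qform_le_sqn G.
have up : (gauss_int G <= (Num.sqrt (pi / lmin) ^+ d)%:E)%E.
  rewrite -(integral_expR_sqn d l0); apply: ge0_le_integral => //.
  - exact: measurable_gauss.
  - by apply/measurable_EFinP; exact: measurable_expR_sqn.
  - by move=> z _; rewrite lee_fin ler_expR lerN2; exact: smallest_eigenvalue_form.
have low : ((Num.sqrt (pi / c) ^+ d)%:E <= gauss_int G)%E.
  rewrite -(integral_expR_sqn d c0); apply: ge0_le_integral => //.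
  - by apply/measurable_EFinP; exact: measurable_expR_sqn.
  - exact: measurable_gauss.
  - by move=> z _; rewrite lee_fin ler_expR lerN2.
case: (gauss_int G) up low => [Z| |]//= _; rewrite lee_fin => hZ; exists Z => //.
apply: lt_le_trans hZ; rewrite exprn_gt0// sqrtr_gt0 divr_gt0//; exact: pi_gt0.
Qed.

Lemma integral_gaussian_sqr :
  (\int[lebesgue_Rn R d]_z ((gaussian G z) ^+ 2)%:E = gauss_int G)%E.
Proof.
apply: eq_integral => z _; congr (_%:E).
rewrite /gaussian -/(qform G (colvec z)) -expRM_natl; congr expR.
by move: (qform _ _) => t; field.
Qed.

Lemma gaussian_le v : `|expR (- (2^-1) * qform G v)| <= expR (- (lmin / 2 * sqn v)).
Proof.
rewrite ger0_norm ?expR_ge0// ler_expR.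
by have := smallest_eigenvalue_form v; lra.
Qed.

Variables (l : nat) (s : 'I_d -> seq R) (sigma : R).
Hypothesis hrank : forall k : 'I_d, (0 < k)%N -> (\rank (subdiag_block G k) <= l)%N.
Hypothesis hs : forall k : 'I_d, (0 < k)%N -> singular_values (subdiag_block G k) (s k).
Hypothesis hsig : forall k : 'I_d, (0 < k)%N -> nth 0 (s k) 0 <= sigma.

Lemma cut_selection (eps Z : R) (k : nat) :
  (2 <= d)%N -> 0 <= sigma -> 0 < eps -> eps < 1 ->
  1 <= rank_base d l sigma lmin eps ->
  gauss_int G = Z%:E -> 0 <= Z -> (0 < k < d)%N ->
  exists (N rk : nat),
    [/\ sep_rank rk (cut_approx k G N), (1 <= rk)%N,
        rk%:R <= rank_base d l sigma lmin eps ^+ l &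
        (\int[lebesgue_Rn R d]_z
           ((expR (- (2^-1) * qform G (colvec z)) -
             cut_approx k G N (colvec z) (colvec z)) ^+ 2)%:E <=
         (eps ^+ 2 / (2 * d%:R) * Z)%:E)%E].
Proof.
move=> d2 sig0 e0 e1 hb GZ Z0 /andP[k0 kd].
have l0 := smallest_eigenvalue_gt0; have Gl := smallest_eigenvalue_form.
have dR : 0 < d%:R :> R by rewrite ltr0n (leq_trans _ d2).
pose kk : 'I_d := Ordinal kd.
have Gsig := sqn_cutmx_le (hs (k0 : (0 < kk)%N)) (hsig (k0 : (0 < kk)%N)).
have rl : (\rank (cutmx k G) <= l)%N.
  exact: leq_trans (rank_cutmx_le G kk) (hrank (k0 : (0 < kk)%N)).
have rd : (\rank (cutmx k G) <= d)%N by exact: rank_leq_row.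
have [A0|A0] := eqVneq (cutmx k G) 0.
  exists 1%N, 1%N; split => //.
  - by have := cut_approx_sep k G 0; rewrite A0 mxrank0 bin0.
  - exact: exprn_ege1.
  rewrite integral0_eq; last first.
    by move=> z _; rewrite (cut_approx_rank0 Gsym _ A0) subrr expr0n.
  rewrite lee_fin; apply: mulr_ge0 => //.
  by apply: divr_ge0; [exact: sqr_ge0 | apply: mulr_ge0 => //; exact: ltW].
have r0 : (0 < \rank (cutmx k G))%N by rewrite lt0n mxrank_eq0.
(* If sigma were 0, [Gsig] would make every column of [cutmx k G] vanish. *)
have sigp : 0 < sigma.
  rewrite lt_def sig0 andbT; apply: contra A0 => /eqP sE.
  apply/eqP/matrixP => i j.
  have := Gsig (delta_mx j 0); rewrite sE expr0n/= mul0r => h.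
  have : cutmx k G *m (delta_mx j 0 : 'cV_d) == 0.
    by rewrite -sqn_eq0 eq_le h sqn_ge0.
  by rewrite -colE => /eqP/matrixP/(_ i 0); rewrite !mxE.
have [N [hN1 hN2]] := taylor_degree d2 r0 rl rd l0 sigp e0 e1 hb.
exists N.+1, 'C(N + \rank (cutmx k G), \rank (cutmx k G)); split => //.
- exact: cut_approx_sep.
- by rewrite bin_gt0 leq_addl.
apply: (le_trans (cut_approx_error Gsym l0 Gl sigp Gsig N.+1)).
rewrite GZ -EFinM lee_fin; apply: ler_wpM2r => //.
have q0 : 0 < (1 + lmin / sigma / 2) ^+ (2 * N.+1).
  by rewrite exprn_gt0// addr_gt0// !divr_gt0.
(* After clearing denominators this is the second conclusion of [taylor_degree], the 4 being the
   product of the 2 of the reflection and the 2 of the budget. *)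
rewrite ler_pdivrMr// -mulrAC ler_pdivlMr ?mulr_gt0//; lra.
Qed.

End PositiveDefinite.

Lemma has_ftt0 (R : realType) d : (0 < d)%N ->
  has_ftt (fun _ : Rn R d => 0) (fun=> 1%N).
Proof.
move=> d0; split=> //; exists (fun j a t b => 0); split.
  by move=> j a b _; exact: measurable_cst.
apply/aeW => z _; rewrite /ftt_eval big1// => a _.
by rewrite (bigD1 (Ordinal d0))//= mul0r.
Qed.

Theorem theorem3p1 (R : realType) (d : nat) (hd : (2 <= d)%N)
  (G : 'M[R]_d) (Gsym : G^T = G) (Gpos : posdefmx G)
  (lmin : R) (hlmin : smallest_eigenvalue G lmin)
  (l : nat) (hl : (1 <= l)%N)
  (hrank : forall k : 'I_d, (0 < k)%N -> (\rank (subdiag_block G k) <= l)%N)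
  (s : 'I_d -> seq R)
  (hs : forall k : 'I_d, (0 < k)%N -> singular_values (subdiag_block G k) (s k))
  (sigma : R)
  (hsigma : sigma = \big[Num.max/0]_(k < d | (0 < k)%N)
                      \big[Num.max/0]_(i < l) nth 0 (s k) i)
  (eps : R) (heps : 0 < eps)
  (heps1 : 1 <= rank_base d l sigma lmin eps) :
  exists (fhat : Rn R d -> R) (r : nat -> nat),
    [/\ fhat \in Lfun (lebesgue_Rn R d) 2%:E,
        ('N[lebesgue_Rn R d]_2%:E[EFin \o (gaussian G \- fhat)%R] <=
           eps%:E * 'N[lebesgue_Rn R d]_2%:E[EFin \o gaussian G])%E,
        has_ftt fhat r &
        forall k : nat, (0 < k < d)%N ->
          (r k)%:R <=
            ((1 + 7 * (sigma / lmin)) * ln (Num.sqrt 8 * d%:R / eps)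
             + ln (expR (3 / 2) * (l%:R / 2))) ^+ l <=
            ((1 + 7 * (sigma / lmin)) * ln (7 * l%:R * (d%:R / eps))) ^+ l].
Proof.
have l0 := smallest_eigenvalue_gt0 Gpos hlmin.
have hsig (k : 'I_d) : (0 < k)%N -> nth 0 (s k) 0 <= sigma.
  move=> k0; rewrite hsigma; apply: le_trans (le_bigmax_cond _ _ k0).
  exact: (le_bigmax 0 (fun i : 'I_l => nth 0 (s k) i) (Ordinal hl)).
have sig0 : 0 <= sigma.
  apply: le_trans (hsig (Ordinal hd) isT).
  by have [_ + _] := hs (Ordinal hd) isT; case: (s _) => //= x s' /andP[].
have d0 : (0 < d)%N by exact: leq_trans hd.
have [Z Z0 GZ] := gauss_int_fin Gsym Gpos hlmin.
have base_le : rank_base d l sigma lmin eps ^+ l <=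
    ((1 + 7 * (sigma / lmin)) * ln (7 * l%:R * (d%:R / eps))) ^+ l.
  have h := rank_base_le d0 hl heps (divr_ge0 sig0 (ltW l0)).
  by apply: lerXn2r => //; rewrite nnegrE; lra.
suff [fhat [r [mfhat fin hftt hr err]]] : exists (fhat : Rn R d -> R) (r : nat -> nat),
    [/\ measurable_fun [set: Rn R d] fhat,
      (\int[lebesgue_Rn R d]_z ((fhat z) ^+ 2)%:E < +oo)%E, has_ftt fhat r,
      forall k : nat, (0 < k < d)%N -> (r k)%:R <= rank_base d l sigma lmin eps ^+ l &
      (\int[lebesgue_Rn R d]_z ((gaussian G z - fhat z) ^+ 2)%:E <=
        (eps ^+ 2 * Z)%:E)%E].
  exists fhat, r; split => //.
  - exact: Lfun2_of_sqr.
  - apply: le_Lnorm2; first exact: ltW.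
    by rewrite integral_gaussian_sqr GZ -EFinM.
  by move=> k kd; rewrite -/(rank_base d l sigma lmin eps) hr.
(* For [1 <= eps] the zero function is accurate enough; its ranks 1 obey the bound by [heps1]. *)
have [e1|e1] := leP 1 eps.
  exists (fun=> 0), (fun=> 1%N); split.
  - exact: measurable_cst.
  - by rewrite expr0n integral0.
  - exact: has_ftt0.
  - by move=> k _; exact: exprn_ege1.
  under eq_integral do rewrite subr0.
  rewrite integral_gaussian_sqr GZ lee_fin ler_peMl ?(ltW Z0)//.
  exact: exprn_ege1.
case: d => [//|n] in hd G Gsym Gpos hlmin hrank s hs hsigma heps1 hsig d0 GZ base_le *.
pose good (k : nat) (p : nat * nat) := (0 < k < n.+1)%N ->
  [/\ sep_rank p.2 (cut_approx k G p.1), (1 <= p.2)%N,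
    p.2%:R <= rank_base n.+1 l sigma lmin eps ^+ l &
    (\int[lebesgue_Rn R n.+1]_z
       ((expR (- (2^-1) * qform G (colvec z)) -
         cut_approx k G p.1 (colvec z) (colvec z)) ^+ 2)%:E <=
     (eps ^+ 2 / (2 * n.+1%:R) * Z)%:E)%E].
have /choice[p hp] k : exists q, good k q.
  rewrite /good; have [kd|kd] := boolP (0 < k < n.+1)%N; last by exists (0%N, 0%N).
  have [N [rk h]] := cut_selection Gsym Gpos hlmin hrank hs hsig hd sig0 heps e1
    heps1 GZ (ltW Z0) kd.
  by exists (N, rk).
pose r k := if (0 < k < n.+1)%N then (p k).2 else 1%N.
have Gl := smallest_eigenvalue_form Gsym hlmin.
have lh : 0 < lmin / 2 by rewrite divr_gt0.
have [||||||||||||fhat [mfhat fin hftt err]] := @ftt_discretization R n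
  (fun v => expR (- (2^-1) * qform G v)) (fun k v => cut_approx k G (p k).1 v v) r
  (lmin / 2) (eps ^+ 2 / 2 * Z) (fun=> eps ^+ 2 / (2 * n.+1%:R) * Z) lh.
- exact: seq_cont_gaussian.
- by move=> k; exact: seq_cont_cut_approx.
- exact: gaussian_le.
- by move=> k v; exact: cut_approx_le.
- apply: measurable_expR_comp; apply: measurable_funM; first exact: measurable_cst.
  exact: measurable_qform.
- by move=> k; exact: measurable_cut_approx.
- by [].
- by rewrite /r ltnn andbF.
- by move=> k kd; rewrite /r kd; have [] := hp k kd.
- move=> k m kd; rewrite /r kd; have [[phi [psi h]] _ _ _] := hp k kd.
  exists (fun t => phi (gridpt R n.+1 m t)).
  exists (fun b t => psi b (gridpt R n.+1 m (nseq k 0%N ++ t))) => t ts.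
  by rewrite cut_approx_gridpt ?h//; case/andP: kd => _ /ltnW.
- by move=> k kd; have [] := hp k kd.
(* With d = n + 1 there are n cuts, each with a share 1 / (n + 1) of [eps ^+ 2 / 2 * Z]: the sum is
   strictly smaller, as the discretization requires. *)
- rewrite sumr_const_nat subn1 /= -[ltLHS]mulr_natl.
  have nR : 0 < n.+1%:R :> R by [].
  have nn : n%:R < n.+1%:R :> R by rewrite ltr_nat.
  have e2 : 0 < eps ^+ 2 * Z by rewrite mulr_gt0// exprn_gt0.
  have -> : n%:R * (eps ^+ 2 / (2 * n.+1%:R) * Z) = (n%:R / n.+1%:R) * (eps ^+ 2 / 2 * Z).
    by field; rewrite gt_eqF.
  rewrite gtr_pMl; last by rewrite mulr_gt0// divr_gt0// exprn_gt0.
  by rewrite ltr_pdivrMr// mul1r.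
exists fhat, r; split => //.
  by move=> k kd; rewrite /r kd; have [] := hp k kd.
apply: (le_trans err); rewrite lee_fin le_eqVlt; apply/orP; left; apply/eqP.
by field.
Qed.
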